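(* Let $X$ be a separable Banach space over a locally compact infinite field $\mathbf K$ with a nontrivial valuation such that either $\mathbf K\supset\mathbf Q_p$ or $\mathrm{char}(\mathbf K)=p>0$, and let $s\neq p$ be a prime. Then there are probability measures $\mu$ on $X$ with values in $\mathbf K_s$ such that $\mu$ is quasi-invariant relative to a dense $\mathbf K$-linear subspace $J_\mu$ of $X$.
   Context: The valuation is non-Archimedean. $\mathbf K_s$ is a finite algebraic extension of $\mathbf Q_s$ with the norm extending that of $\mathbf Q_s$. $Bco(X)$ is the algebra of clopen subsets of $X$. A $\mathbf K_s$-valued measure on $X$ (on an algebra $E\supset Bco(X)$) is $\mu:E\to\mathbf K_s$ such that: (i) $\mu$ is additive, $\mu(\emptyset)=0$; (ii) $\|A\|_\mu:=\sup\{|\mu(B)|:B\in E,B\subset A\}<\infty$; (iii) if $F\subset E$ is shrinking (for $A,B\in F$ there is $C\in F$ with $C\subset A\cap B$) and $\bigcap F=\emptyset$, then $\lim_{A\in F}\mu(A)=0$. Probability: $\|X\|_\mu=1=\mu(X)$. $N_\mu(x):=\inf\{\|U\|_\mu:x\in U\in Bco(X)\}$; $L(X,\mu,\mathbf K_s)$ is the Banach space of classes of $\mu$-integrable functions with norm $\sup_x|f(x)|N_\mu(x)$ (limits of $E$-simple functions). $\nu\ll\mu$ means there is $f\in L(X,\mu,\mathbf K_s)$ with $\nu(A)=\int_Af\,d\mu$ for all $A\in Bco(X)$. For $a\in X$ put $\mu_a(A):=\mu(A-a)$ and $M_\mu:=\{a\in X:\mu_a\ll\mu\}$. The measure $\mu$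 is quasi-invariant (relative to $J_\mu$) if $M_\mu$ contains a $\mathbf K$-linear subspace $J_\mu$ dense in $X$. *)

(* Defs.v *)
From HB Require Import structures.
From mathcomp Require Import all_boot all_order all_algebra all_field.
From mathcomp Require Import all_classical all_reals topology ereal.

Set Implicit Arguments.
Unset Strict Implicit.
Unset Printing Implicit Defensive.

Import Order.TTheory GRing.Theory Num.Theory.
Import numFieldTopology.Exports.

Local Open Scope classical_set_scope.
Local Open Scope ring_scope.

(** * Non-Archimedean valued fields and normed spaces

The norm cannot be that of [Num.NormedZmodule]: the latter satisfies
[`|x *+ n| = `|x| *+ n], which is incompatible with the strong triangle
inequality.  Only [topology] and [ereal] are loaded because [tvs] declares the
joins of topological spaces and left modules for a [numDomainType] of scalars,
which would exclude [ultraNormedModType] below. *)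

HB.mixin Record Zmodule_isUltraNormed (R : realType) V
    & GRing.Zmodule V & PseudoPointedMetric R V := {
  vnorm : V -> R ;
  vnorm_ge0 : forall x, 0 <= vnorm x ;
  vnorm_eq0 : forall x, (vnorm x == 0) = (x == 0) ;
  vnormN : forall x, vnorm (- x) = vnorm x ;
  vnormD_max : forall x y, vnorm (x + y) <= Num.max (vnorm x) (vnorm y) ;
  vnorm_ballE : ball = ball_ vnorm
}.

#[short(type="ultraNormedZmodType")]
HB.structure Definition UltraNormedZmod (R : realType) :=
  {V of GRing.Zmodule V & PseudoPointedMetric R V
      & Zmodule_isUltraNormed R V}.

(* This structure and [PreUltraNormedModule] are joins required by
   Hierarchy-Builder. *)
HB.structure Definition CompleteUltraNormedZmod (R : realType) :=
  {V of UltraNormedZmod R V & Complete V}.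

HB.mixin Record Field_isValued (R : realType) K
    & GRing.Field K & UltraNormedZmod R K := {
  vnormM : forall x y : K, vnorm (x * y) = vnorm x * vnorm y
}.

#[short(type="valuedFieldType")]
HB.structure Definition ValuedField (R : realType) :=
  {K of GRing.Field K & UltraNormedZmod R K & Field_isValued R K}.

HB.structure Definition PreUltraNormedModule (R : realType) (K : pzRingType) :=
  {V of GRing.Lmodule K V & UltraNormedZmod R V}.

HB.mixin Record Lmodule_isUltraNormed (R : realType) (K : valuedFieldType R) V
    & GRing.Lmodule K V & UltraNormedZmod R V := {
  vnormZ : forall (a : K) (x : V), vnorm (a *: x) = vnorm a * vnorm x
}.

#[short(type="ultraNormedModType")]
HB.structure Definition UltraNormedModule (R : realType)
    (K : valuedFieldType R) :=
  {V of GRing.Lmodule K V & UltraNormedZmod R V & Lmodule_isUltraNormed R K V}.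

#[short(type="ultraBanachType")]
HB.structure Definition UltraBanach (R : realType) (K : valuedFieldType R) :=
  {V of UltraNormedModule R K V & Complete V}.

(** * The p-adic numbers

A [padicFieldType R p] is a completion of the rationals for the p-adic
absolute value; it is unique up to a unique isometric isomorphism. *)

Definition padic_abs (R : realType) (p : nat) (q : rat) : R :=
  if q == 0 then 0
  else p%:R ^+ logn p `|denq q| / p%:R ^+ logn p `|numq q|.

HB.mixin Record ValuedField_isPadic (R : realType) (p : nat) K
    & ValuedField R K := {
  vnorm_ratr : forall q : rat, vnorm (ratr q : K) = padic_abs R p q ;
  dense_ratr : dense (range (ratr : rat -> K))
}.

#[short(type="padicFieldType")]
HB.structure Definition PadicField (R : realType) (p : nat) :=
  {K of ValuedField R K & Complete K & ValuedField_isPadic R p K}.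

HB.mixin Record FieldExt_isValued (R : realType) (F : valuedFieldType R) L
    & FieldExt F L & ValuedField R L := {
  vnorm_in_alg : forall a : F, vnorm (a%:A : L) = vnorm a
}.

(** [fieldExtType] is the type of finite extensions. *)
#[short(type="valuedFieldExtType")]
HB.structure Definition ValuedFieldExt (R : realType) (F : valuedFieldType R) :=
  {L of FieldExt F L & ValuedField R L & FieldExt_isValued R F L}.

(** * Measures with values in a valued field

A measure is given by an algebra of sets [E] and a total function [mu] on
sets, of which only the values on [E] are relevant. *)

Section measures.
Context {R : realType} {X : topologicalType} {L : valuedFieldType R}.
Implicit Types (E : set (set X)) (mu nu : set X -> L) (A : set X) (f g : X -> L).

Definition measure_values E mu A : set R :=
  [set vnorm (mu B) | B in [set B | E B /\ B `<=` A]].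

Definition measure_norm E mu A : R := sup (measure_values E mu A).

Definition shrinking (F : set (set X)) :=
  forall A B, F A -> F B -> exists2 C, F C & C `<=` A `&` B.

(** The sections of a shrinking family [F], directed by reverse inclusion. *)
Definition shrinking_filter (F : set (set X)) : set_system (set X) :=
  filter_from F (fun A => [set B | F B /\ B `<=` A]).

Record is_measure E mu : Prop := IsMeasure {
  measure_setT : E setT ;
  measure_setU : forall A B, E A -> E B -> E (A `|` B) ;
  measure_setC : forall A, E A -> E (~` A) ;
  measure_clopen : [set A | clopen A] `<=` E ;
  measure_set0 : mu set0 = 0 ;
  measure_additive : forall A B, E A -> E B -> A `&` B = set0 ->
    mu (A `|` B) = mu A + mu B ;
  measure_bounded : forall A, E A -> has_ubound (measure_values E mu A) ;
  measure_shrinking : forall F : set (set X),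
    F `<=` E -> shrinking F -> \bigcap_(A in F) A = set0 ->
    mu A @[A --> shrinking_filter F] --> (0 : L)
}.

Definition is_probability E mu :=
  measure_norm E mu setT = 1 /\ mu setT = 1.

(** The function N_mu. *)
Definition measure_density E mu (x : X) : R :=
  inf [set measure_norm E mu U | U in [set U | clopen U /\ U x]].

(** The norm sup_x |f(x)| N_mu(x) of L(X, mu). *)
Definition measure_seminorm E mu f : \bar R :=
  ereal_sup [set (vnorm (f x) * measure_density E mu x)%:E | x in [set: X]].

Definition simple_fun E g :=
  finite_set (range g) /\ forall y, E (g @^-1` [set y]).

Definition simple_integral mu A g : L :=
  \sum_(y \in range g) y * mu (A `&` g @^-1` [set y]).

Definition simple_approx E mu f (h : nat -> X -> L) :=
  (forall n, simple_fun E (h n)) /\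
  measure_seminorm E mu (f \- h n) @[n --> \oo] --> 0%E.

Definition mu_integrable E mu f := exists h, simple_approx E mu f h.

(** [has_integral E mu A f v] means that the integral of [f] over [A] is [v]. *)
Definition has_integral E mu A f (v : L) :=
  exists2 h, simple_approx E mu f h &
    simple_integral mu A (h n) @[n --> \oo] --> v.

Definition abs_continuous nu E mu :=
  exists2 f, mu_integrable E mu f &
    forall A, clopen A -> has_integral E mu A f (nu A).

End measures.

Section quasi_invariance.
Context {R : realType} {K : valuedFieldType R} {X : ultraNormedModType K}
  {L : valuedFieldType R}.
Implicit Types (E : set (set X)) (mu : set X -> L).

Definition translate mu (a : X) : set X -> L :=
  fun A => mu [set x - a | x in A].

Definition admissible_shifts E mu : set X :=
  [set a | abs_continuous (translate mu a) E mu].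

Definition quasi_invariant E mu (J : {pred X}) :=
  [/\ submod_closed J, dense [set` J] & [set` J] `<=` admissible_shifts E mu].

End quasi_invariance.

(* Main.v *)
Require Import Defs.
From mathcomp Require Import all_boot all_order all_algebra all_field.
From mathcomp Require Import all_classical all_reals topology ereal.

Set Implicit Arguments.
Unset Strict Implicit.
Unset Printing Implicit Defensive.

Import Order.TTheory GRing.Theory Num.Theory.

Local Open Scope classical_set_scope.
Local Open Scope ring_scope.

(** Let [z_0, z_1, ...] be a null sequence whose scalar multiples are dense in
[X], and let [G] be the closed subgroup generated by the [c *: z_i] with [c] in
a small compact ball of [K].  It is compact and [p]-primary modulo every ball,
so that averaging a locally constant function over the multiples
[0, ..., p^m - 1] of finitely many generators stabilizes; as [p] has norm [1]
in [Q_s], this yields a Haar measure of [G] with values of norm at most [1].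
Adding to [G] finitely many further multiples of the [z_i] at a time gives an
increasing sequence of compact groups [H_n], each a finite union of cosets of
[G], whose union contains a dense [K]-subspace [J].  The measure is
[mu = (1 - s) * sum_n s^n Haar(H_n)].

On a coset of [G] in [H_n] but not in [H_(n-1)], [mu] is a multiple of Haar
measure whose factor has norm [s^-n], hence is not zero.  For [a] in [H_M], the
terms of index at least [M] are invariant under [a], and the others live on
[H_M].  So [mu_a] has a density with respect to [mu] that is constant on each
of the finitely many cosets of [G] in [H_M] and is [1] elsewhere.  The algebra
of sets is taken larger than the clopen sets, so as to contain the cosets of
[G]: this density is then a simple function. *)

(** * Averages over multiples of group elements *)

Section subgroups.
Context {X : zmodType}.
Implicit Types (T B : set X) (l : seq X).

Definition subgroup T := T 0 /\ forall x y, T x -> T y -> T (x - y).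

Lemma subgroupN T x : subgroup T -> T x -> T (- x).
Proof. by move=> [T0 TB] Tx; rewrite -sub0r; exact: TB. Qed.

Lemma subgroupD T x y : subgroup T -> T x -> T y -> T (x + y).
Proof.
by move=> sT Tx Ty; rewrite -[y]opprK; apply: sT.2 => //; exact: subgroupN.
Qed.

Lemma subgroupMn T x n : subgroup T -> T x -> T (x *+ n).
Proof.
move=> sT Tx; elim: n => [|n IH]; first by rewrite mulr0n; exact: sT.1.
by rewrite mulrS; exact: subgroupD.
Qed.

Lemma subgroupMz T x (n : int) : subgroup T -> T x -> T (x *~ n).
Proof.
move=> sT Tx; case: n => n; first by rewrite -pmulrn; exact: subgroupMn.
by rewrite NegzE mulrNz -pmulrn; apply: subgroupN => //; exact: subgroupMn.
Qed.

Lemma subgroup_addr T x y : subgroup T -> T y -> T (x + y) = T x.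
Proof.
move=> sT Ty; apply/propext; split=> [Txy|Tx]; last exact: subgroupD.
by rewrite -[x](addrK y); exact: sT.2.
Qed.

Lemma subgroup_subr T x y : subgroup T -> T y -> T (x - y) = T x.
Proof. by move=> sT Ty; rewrite subgroup_addr//; exact: subgroupN. Qed.

(** The subgroup generated by [B] and the elements of [l]. *)
Definition ext l B : set X :=
  foldr (fun w T => [set x | exists c : int, T (x - w *~ c)]) B l.

Lemma subgroup_ext l B : subgroup B -> subgroup (ext l B).
Proof.
move=> sB; elim: l => //= w l [IH0 IHB]; split=> [|x y [c Tc] [d Td]].
  by exists 0; rewrite mulr0z subr0.
exists (c - d); rewrite mulrzBr opprB [_ - w *~ c]addrC addrACA.
by rewrite -[w *~ d]opprK -opprD; exact: IHB.
Qed.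

Lemma sub_ext l B : B `<=` ext l B.
Proof.
by elim: l => //= w l IH x Bx; exists 0; rewrite mulr0z subr0; exact: IH.
Qed.

Lemma mem_ext l B x : subgroup B -> x \in l -> ext l B x.
Proof.
move=> sB; elim: l => //= w l IH; rewrite inE => /predU1P[->|xl].
  by exists 1; rewrite mulr1z subrr; exact: (subgroup_ext l sB).1.
by exists 0; rewrite mulr0z subr0; exact: IH.
Qed.

Lemma ext_min l B T : subgroup T -> {in l, forall x, T x} -> B `<=` T ->
  ext l B `<=` T.
Proof.
move=> sT; elim: l => //= w l IH lT BT x [c xc].
rewrite -(subrK (w *~ c) x); apply: subgroupD => //; last first.
  by apply: subgroupMz => //; apply: lT; rewrite mem_head.
by apply: IH xc => // y yl; apply: lT; rewrite inE yl orbT.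
Qed.

Lemma extS l l' B B' : subgroup B' -> {subset l <= l'} -> B `<=` B' ->
  ext l B `<=` ext l' B'.
Proof.
move=> sB' ll' BB'; apply: ext_min; first exact: subgroup_ext.
  by move=> x /ll' xl'; exact: mem_ext.
by apply: subset_trans BB' _; exact: sub_ext.
Qed.

(** The element [z] collects the integer multiples of the generators, so it is an honest finite
    combination of [l]; what remains lies in [B]. *)
Lemma ext_split l B x : ext l B x -> exists2 z, ext l [set 0] z & B (x - z).
Proof.
elim: l x => [|w l IH] x /=; first by exists 0; rewrite ?subr0.
move=> [c /IH[z lz Bz]]; exists (z + w *~ c); first by exists c; rewrite addrK.
by rewrite [z + _]addrC opprD addrA.
Qed.

(** Finite index: the coefficient of each generator can be reduced modulo an exponent that sends it
    into [B]. This gives both the total boundedness of the compact group and the finiteness of its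
    cosets in the larger groups. *)
Lemma ext_cosets l B : subgroup B ->
  {in l, forall w, exists2 k, (0 < k)%N & B (w *+ k)} ->
  exists R : seq X, {in R, forall r, ext l B r} /\
    forall x, ext l B x -> exists2 r, r \in R & B (x - r).
Proof.
move=> sB; elim: l => [|w l IH] lB.
  exists [:: 0]; split=> [x|x /= Bx].
    by rewrite inE => /eqP->; exact: sB.1.
  by exists 0; rewrite ?mem_head ?subr0.
have [R [RB BR]] : _ := IH (fun y yl => lB y (@mem_behead _ (w :: l) y yl)).
have [k k0 Bk] := lB _ (mem_head _ _).
exists [seq w *+ c + r | c <- iota 0 k, r <- R]; split=> [x|x [c xc]].
  move=> /allpairsP[[c r]] /= [_ rR ->]; exists (Posz c).
  by rewrite -pmulrn addrAC subrr add0r; exact: RB.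
have /BR[r rR] : ext l B (x - w *~ (c %% Posz k)%Z).
  rewrite [in X in X (_ - _)]/ext.
  (* Replacing [c] by its remainder changes the point by a multiple of [w *+ k], which lies in
     [B]. *)
  have -> : x - w *~ (c %% Posz k)%Z =
      x - w *~ c + (w *+ k) *~ (c %/ Posz k)%Z.
    rewrite pmulrn -mulrzA [Posz k * _]mulrC /modz mulrzBr opprB.
    by rewrite addrCA addrC.
  rewrite subgroup_addr//; first exact: subgroup_ext.
  apply: subgroupMz; first exact: subgroup_ext.
  exact: sub_ext.
move=> Br.
have : exists n : nat, (n < k)%N /\ (c %% Posz k)%Z = n.
  have : (0 <= c %% Posz k)%Z by rewrite modz_ge0// eqz_nat -lt0n.
  have : (c %% Posz k < Posz k)%Z by rewrite ltz_pmod.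
  by case: (c %% Posz k)%Z => // n nk _; exists n.
move=> [n [nk E]]; exists (w *+ n + r).
  by apply/allpairsP; exists (n, r); rewrite mem_iota.
by move: Br; rewrite E -pmulrn opprD addrA.
Qed.

End subgroups.

Section averages.
Context {X : zmodType} {F : fieldType} (p : nat).
Context (p_neq0 : p%:R != 0 :> F).
Implicit Types (phi psi : X -> F) (m : nat) (x y : X) (l : seq X).

Definition avg m y phi x : F :=
  (p%:R ^+ m)^-1 * \sum_(c < p ^ m) phi (x + y *+ c).

Definition avgs m l phi : X -> F := foldr (avg m) phi l.

Definition periods phi : set X := [set v | forall x, phi (x + v) = phi x].

Lemma subgroup_periods phi : subgroup (periods phi).
Proof.
split=> [x|u v pu pv x]; first by rewrite addr0.
by rewrite -[LHS]pv -addrA subrK.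
Qed.

Lemma avg_periods m y phi : periods phi `<=` periods (avg m y phi).
Proof.
by move=> v pv x; congr (_ * _); apply: eq_bigr => c _; rewrite addrAC pv.
Qed.

Lemma avg_id m y phi : periods phi y -> avg m y phi = phi.
Proof.
move=> py; apply/funext => x; rewrite /avg.
under eq_bigr => c _.
  rewrite (subgroupMn (nat_of_ord c) (subgroup_periods phi) py); over.
rewrite sumr_const card_ord -[phi x *+ _]mulr_natl natrX mulrA mulVf ?mul1r//.
by rewrite expf_neq0.
Qed.

(** A shift by [y] moves the sum one step along the multiples of [y]: the term [c = 0] is lost and
    [c = p ^ m] gained, and these two agree by hypothesis. *)
Lemma avg_self m y phi :
  periods phi (y *+ (p ^ m)) -> periods (avg m y phi) y.
Proof.
move=> pv x; congr (_ * _).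
have [k E] : exists k, (p ^ m)%N = k.+1.
  exists (p ^ m).-1; rewrite prednK// expn_gt0; case: p p_neq0 => //.
  by rewrite eqxx.
rewrite E big_ord_recr big_ord_recl /= addrC mulr0n addr0; congr (_ + _).
  by rewrite -addrA -mulrS -E pv.
by apply: eq_bigr => i _; rewrite -addrA -mulrS.
Qed.

Lemma avgC m y m' y' phi : avg m y (avg m' y' phi) = avg m' y' (avg m y phi).
Proof.
apply/funext => x; rewrite /avg -!mulr_sumr mulrCA; congr (_ * (_ * _)).
rewrite exchange_big; apply: eq_bigr => i _; apply: eq_bigr => j _.
by rewrite addrAC.
Qed.

Lemma avgs_cat m l l' phi : avgs m (l ++ l') phi = avgs m l (avgs m l' phi).
Proof. exact: foldr_cat. Qed.

Lemma avgs_avgC m l m' y phi :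
  avgs m l (avg m' y phi) = avg m' y (avgs m l phi).
Proof. by elim: l => //= w l ->; rewrite avgC. Qed.

Lemma avgsC m l m' l' phi :
  avgs m l (avgs m' l' phi) = avgs m' l' (avgs m l phi).
Proof. by elim: l' => //= w l' <-; rewrite avgs_avgC. Qed.

Lemma avgs_periods m l phi : periods phi `<=` periods (avgs m l phi).
Proof.
by elim: l => //= w l IH; apply: subset_trans IH _; exact: avg_periods.
Qed.

Lemma avgs_id m l phi : {in l, forall y, periods phi y} -> avgs m l phi = phi.
Proof.
elim: l => //= w l IH lphi; rewrite IH.
  by rewrite avg_id//; apply: lphi; rewrite mem_head.
by move=> y yl; apply: lphi; rewrite inE yl orbT.
Qed.

Lemma avgs_self m l phi : {in l, forall y, periods phi (y *+ (p ^ m))} ->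
  {in l, forall y, periods (avgs m l phi) y}.
Proof.
elim: l => //= w l IH lphi y; rewrite inE => /predU1P[->|yl].
  by apply: avg_self; apply: avgs_periods; apply: lphi; rewrite mem_head.
apply: avg_periods; apply: IH yl => z zl; apply: lphi.
by rewrite inE zl orbT.
Qed.

(** The averages at [x] evaluate the function on the coset [x + T] only, so it may be modified
    freely elsewhere. *)
Lemma avgs_local (T : set X) m l phi psi x : subgroup T ->
  {in l, forall y, T y} -> (forall t, T t -> phi (x + t) = psi (x + t)) ->
  avgs m l phi x = avgs m l psi x.
Proof.
move=> sT; elim: l x => [|w l IH] x lT phipsi /=.
  by rewrite -[x]addr0; apply: phipsi; exact: sT.1.
have wT : T w by apply: lT; rewrite mem_head.
congr (_ * _); apply: eq_bigr => c _; apply: IH => [y yl|t Tt].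
  by apply: lT; rewrite inE yl orbT.
by rewrite -addrA; apply: phipsi; apply: subgroupD => //; exact: subgroupMn.
Qed.

Lemma avgsD m l phi psi x :
  avgs m l (fun x => phi x + psi x) x = avgs m l phi x + avgs m l psi x.
Proof.
elim: l x => //= w l IH x; rewrite /avg -mulrDr -big_split.
by congr (_ * _); apply: eq_bigr => c _; exact: IH.
Qed.

Lemma avgsZ m l a phi x : avgs m l (fun x => a * phi x) x = a * avgs m l phi x.
Proof.
elim: l x => //= w l IH x; rewrite /avg mulrCA; congr (_ * _).
by rewrite mulr_sumr; apply: eq_bigr => c _; exact: IH.
Qed.

Lemma avgs_shift m l phi a x :
  avgs m l (fun x => phi (x + a)) x = avgs m l phi (x + a).
Proof.
elim: l x => //= w l IH x; congr (_ * _); apply: eq_bigr => c _.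
by rewrite IH addrAC.
Qed.

Lemma avgs_cst m l a : avgs m l (fun=> a) = (fun=> a).
Proof. by apply: avgs_id => y _ x. Qed.

End averages.

(** * Ultrametric groups and compact subgroups *)

Section ultranorm.
Context {R : realType} {V : ultraNormedZmodType R}.
Implicit Types (x y z : V) (e : R).

Lemma vnorm0 : vnorm (0 : V) = 0.
Proof. by apply/eqP; rewrite vnorm_eq0. Qed.

Lemma vnormB x y : vnorm (x - y) = vnorm (y - x).
Proof. by rewrite -vnormN opprB. Qed.

Lemma vnormD_le x y e : vnorm x <= e -> vnorm y <= e -> vnorm (x + y) <= e.
Proof.
by move=> xe ye; apply: le_trans (vnormD_max _ _) _; rewrite ge_max xe.
Qed.

Lemma vnormB_le x y e : vnorm x <= e -> vnorm y <= e -> vnorm (x - y) <= e.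
Proof. by move=> xe ye; apply: vnormD_le; rewrite ?vnormN. Qed.

Lemma vnormD_lt x y e : vnorm x < e -> vnorm y < e -> vnorm (x + y) < e.
Proof.
by move=> xe ye; apply: le_lt_trans (vnormD_max _ _) _; rewrite gt_max xe.
Qed.

Lemma vnormB_lt x y e : vnorm x < e -> vnorm y < e -> vnorm (x - y) < e.
Proof. by move=> xe ye; apply: vnormD_lt; rewrite ?vnormN. Qed.

Lemma vnormMn_le x n : vnorm (x *+ n) <= vnorm x.
Proof.
elim: n => [|n IH]; first by rewrite mulr0n vnorm0 vnorm_ge0.
by rewrite mulrS; exact: vnormD_le.
Qed.

Lemma vnorm_sum_le (I : Type) (r : seq I) (P : pred I) (f : I -> V) e :
  0 <= e -> (forall i, P i -> vnorm (f i) <= e) ->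
  vnorm (\sum_(i <- r | P i) f i) <= e.
Proof.
move=> e0 fe; elim/big_rec: _ => [|i x Pi xe]; first by rewrite vnorm0.
by apply: vnormD_le xe; exact: fe.
Qed.

Definition vball e : set V := [set x | vnorm x < e].

Lemma subgroup_vball e : 0 < e -> subgroup (vball e).
Proof.
by move=> e0; split=> [|x y]; [rewrite /vball /= vnorm0|exact: vnormB_lt].
Qed.

Lemma nbhs_vnormP x (A : set V) :
  nbhs x A <-> exists2 e, 0 < e & forall y, vnorm (x - y) < e -> A y.
Proof.
split=> [/nbhs_ballP[e /= e0 xA]|[e e0 xA]].
  by exists e => // y xy; apply: xA; rewrite vnorm_ballE.
by apply/nbhs_ballP; exists e => //= y; rewrite vnorm_ballE; exact: xA.
Qed.

Lemma cvg_vnormP (I : Type) (D : set_system I) (f : I -> V) x : Filter D ->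
  f i @[i --> D] --> x <->
  forall e, 0 < e -> \forall i \near D, vnorm (x - f i) < e.
Proof.
move=> FD; split=> [/cvg_ballP fx e e0|fx].
  by have := fx _ e0; rewrite vnorm_ballE.
by apply/cvg_ballP => e e0; rewrite vnorm_ballE; exact: fx.
Qed.

End ultranorm.

(** An ultrafilter containing [A] contains one of finitely many balls of each radius; hence it is
    Cauchy and converges. *)
Lemma complete_totally_bounded_compact {R : realType}
    (X : CompleteUltraNormedZmod.type R) (A : set X) : closed A ->
  (forall e : R, 0 < e ->
    exists r : seq X, forall x, A x ->
      exists2 y, y \in r & vnorm (x - y) < e) ->
  compact A.
Proof.
move=> cA tbA; rewrite compact_ultra => F UF FA.
have cF : cauchy_ex F.
  move=> e e0; have [r rA] := tbA _ e0.
  have : F [set x | exists2 y, y \in r & vnorm (x - y) < e].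
    by apply: filterS FA; exact: rA.
  (* Either the ball around the first centre belongs to the ultrafilter, or its complement does and
     the remaining centres suffice. *)
  elim: r {rA} => [/filter_ex[x [y]]//|y r IH Fr].
  have [Fy|Fy] := in_ultra_setVsetC [set x | vnorm (x - y) < e] UF.
    by exists y; apply: filterS Fy => x; rewrite vnorm_ballE /= vnormB.
  apply: IH; apply: filterS (filterI Fy Fr) => x [/= xy [z]].
  by rewrite inE => /predU1P[->//|zr xz]; exists z.
have Fcvg : cvg F by apply: cauchy_cvg; exact: cauchy_exP cF.
exists (lim F); split=> //; apply: cA => B FB; move/Fcvg: FB => FB.
exact: filter_ex (filterI FA FB).
Qed.

Section valued_field.
Context {R : realType} {F : valuedFieldType R}.

Lemma vnorm1 : vnorm (1 : F) = 1.
Proof.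
have n0 : vnorm (1 : F) != 0 by rewrite vnorm_eq0 oner_eq0.
by apply: (mulfI n0); rewrite -vnormM !mulr1.
Qed.

Lemma vnormX (x : F) n : vnorm (x ^+ n) = vnorm x ^+ n.
Proof.
by elim: n => [|n IH]; rewrite ?expr0 ?vnorm1// !exprS vnormM IH.
Qed.

Lemma vnormV (x : F) : vnorm x^-1 = (vnorm x)^-1.
Proof.
have [->|x0] := eqVneq x 0; first by rewrite invr0 vnorm0 invr0.
have n0 : vnorm x != 0 by rewrite vnorm_eq0.
by apply: (mulfI n0); rewrite -vnormM !divff// vnorm1.
Qed.

Lemma vnorm_nat_le1 n : vnorm (n%:R : F) <= 1.
Proof. by rewrite -vnorm1; exact: vnormMn_le. Qed.

(** Dividing by [p ^ m] costs nothing because [p] has norm 1, and the strong triangle inequality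
    bounds the sum. *)
Lemma vnorm_avgs (X : zmodType) p m l (phi : X -> F) x :
  vnorm (p%:R : F) = 1 -> (forall y, vnorm (phi y) <= 1) ->
  vnorm (avgs p m l phi x) <= 1.
Proof.
move=> p1 phi1; elim: l x => //= w l IH x.
rewrite vnormM vnormV vnormX p1 expr1n invr1 mul1r.
by apply: vnorm_sum_le => // i _; exact: IH.
Qed.

End valued_field.

Lemma list_uniform (T : eqType) (Q : T -> nat -> Prop) (l : seq T) :
  {in l, forall y, exists M, forall m, (M <= m)%N -> Q y m} ->
  exists M, forall m, (M <= m)%N -> {in l, forall y, Q y m}.
Proof.
elim: l => [|w l IH] lQ; first by exists 0%N.
have [M wM] := lQ _ (mem_head _ _).
have [M' lM] := IH (fun y yl => lQ y (@mem_behead _ (w :: l) y yl)).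
exists (maxn M M') => m; rewrite geq_max => /andP[Mm M'm] y.
by rewrite inE => /predU1P[->|]; [exact: wM|exact: lM].
Qed.

(** * The compact group generated by a null family of generators *)

Section compact_subgroup.
Context {R : realType} {X : CompleteUltraNormedZmod.type R} (p : nat).
Context (S : nat -> seq X).
Context (S_small : forall e : R, 0 < e ->
  exists N, forall m, {in S m, forall y, y \in S N \/ vnorm y < e}).
Context (p_prime : prime p).
Context (p_tors : forall (x : X) (e : R), 0 < e ->
  exists m, vnorm (x *+ p ^ m) < e).
Implicit Types (x y : X) (e : R) (A B : set X) (l : seq X).

(** The closed subgroup generated by the elements of all the [S m]. *)
Definition closed_span : set X :=
  [set x | forall e, 0 < e -> exists m, ext (S m) (vball e) x].

Local Notation G := closed_span.

Lemma vnormMp_lt x e : 0 < e ->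
  exists M, forall m, (M <= m)%N -> vnorm (x *+ p ^ m) < e.
Proof.
move=> /(p_tors x)[M xM]; exists M => m Mm; rewrite -(subnKC Mm) expnD mulrnA.
by apply: le_lt_trans xM; exact: vnormMn_le.
Qed.

(** Every generator outside [S N] already lies in the ball, so modulo the ball the generated
    subgroup stops growing at [N]. *)
Lemma ext_small e : 0 < e -> exists N, forall m,
  ext (S m) (vball e) `<=` ext (S N) (vball e).
Proof.
move=> e0; have sB := subgroup_vball (V := X) e0.
have [N SN] := S_small e0; exists N => m.
apply: ext_min; [exact: subgroup_ext| |exact: sub_ext].
by move=> y /SN[yN|ye]; [exact: mem_ext|exact: sub_ext].
Qed.

Lemma subgroup_closed_span : subgroup G.
Proof.
split=> [e e0|x y Gx Gy e e0].
  by exists 0%N; apply: (subgroup_ext _ _).1; exact: subgroup_vball.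
have [N SN] := ext_small e0; exists N.
have [m /SN Nx] := Gx e e0; have [m' /SN Ny] := Gy e e0.
by apply: (subgroup_ext _ _).2 => //; exact: subgroup_vball.
Qed.

Lemma mem_closed_span m y : y \in S m -> G y.
Proof.
by move=> ym e e0; exists m; apply: mem_ext => //; exact: subgroup_vball.
Qed.

(** Modulo a ball, an element of [G] is a finite combination of generators. That combination is
    itself in [G], so the error is a small element of [G], and [T] need only absorb such
    elements. *)
Lemma closed_span_min (T : set X) e : subgroup T -> 0 < e ->
  (forall m, {in S m, forall y, T y}) -> G `&` vball e `<=` T -> G `<=` T.
Proof.
move=> sT e0 ST eT x Gx.
have [m /ext_split[z Sz zx]] := Gx e e0.
have Tz : T z by apply: ext_min Sz; [|exact: ST|move=> _ ->; exact: sT.1].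
have Gz : G z.
  apply: ext_min Sz; [exact: subgroup_closed_span|exact: mem_closed_span|].
  by move=> _ ->; exact: subgroup_closed_span.1.
rewrite -(subrK z x); apply: subgroupD => //; apply: eT; split=> //.
exact: subgroup_closed_span.2.
Qed.

Lemma closed_closed_span : closed G.
Proof.
move=> x clx e e0.
have [|y [Gy /= xy]] := clx [set y | vnorm (x - y) < e].
  by apply/nbhs_vnormP; exists e.
have [m ym] := Gy _ e0; exists m; rewrite -(subrK y x) addrC.
have sB := subgroup_vball (V := X) e0.
by rewrite (subgroup_addr _ (subgroup_ext _ sB))//; exact: sub_ext.
Qed.

(** Modulo a ball, [G] lies in a group with finitely many generators, each killed by a power of [p];
    this group is finite, which gives total boundedness. *)
Lemma compact_closed_span : compact G.
Proof.
apply: complete_totally_bounded_compact; first exact: closed_closed_span.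
move=> e e0; have [N SN] := ext_small e0.
have [|y _|r [_ rN]] := @ext_cosets X (S N) (vball e).
- exact: subgroup_vball.
- have [m ym] := p_tors y e0.
  by exists (p ^ m)%N; rewrite ?expn_gt0 ?prime_gt0.
- exists r => x Gx; have [m /SN/rN[z zr xz]] := Gx _ e0.
  by exists z.
Qed.

End compact_subgroup.

(** * The algebra of sets that are clopen on each coset of the compact group *)

Section coset_algebra.
Context {R : realType} {X : CompleteUltraNormedZmod.type R} (p : nat).
Context (S : nat -> seq X).
Context (S_small : forall e : R, 0 < e ->
  exists N, forall m, {in S m, forall y, y \in S N \/ vnorm y < e}).
Context (p_prime : prime p).
Context (p_tors : forall (x : X) (e : R), 0 < e ->
  exists m, vnorm (x *+ p ^ m) < e).
Implicit Types (x y : X) (e : R) (A B : set X) (l : seq X).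

Local Notation G := (closed_span S).
Let sG : subgroup G := subgroup_closed_span S_small.

(** The sets whose trace on every coset of [G] is relatively clopen; since [G]
is compact, this can be stated uniformly on each coset. *)
Definition coset_clopen A := forall x, exists2 e, 0 < e &
  forall g v, G g -> G v -> vnorm v < e -> A (x + g + v) = A (x + g).

Lemma coset_clopenC A : coset_clopen A -> coset_clopen (~` A).
Proof.
move=> EA x; have [e e0 xA] := EA x; exists e => // g v Gg Gv ve.
by rewrite /setC /= xA.
Qed.

Lemma coset_clopenU A B :
  coset_clopen A -> coset_clopen B -> coset_clopen (A `|` B).
Proof.
move=> EA EB x; have [e e0 xA] := EA x; have [d d0 xB] := EB x.
exists (Num.min e d); first by rewrite lt_min e0.
move=> g v Gg Gv; rewrite lt_min => /andP[ve vd].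
by rewrite /setU /= xA// xB.
Qed.

Lemma coset_clopenI A B :
  coset_clopen A -> coset_clopen B -> coset_clopen (A `&` B).
Proof.
move=> EA EB; rewrite -[A]setCK -[B]setCK -setCU; apply: coset_clopenC.
by apply: coset_clopenU; exact: coset_clopenC.
Qed.

Lemma coset_clopen_shift A a :
  coset_clopen A -> coset_clopen [set x | A (x + a)].
Proof.
move=> EA x; have [e e0 xA] := EA (x + a); exists e => // g v Gg Gv ve /=.
by rewrite addrAC [x + g + a]addrAC xA.
Qed.

Lemma coset_clopen_saturated A :
  (forall x v, G v -> A (x + v) = A x) -> coset_clopen A.
Proof. by move=> GA x; exists 1 => // g v Gg Gv _; rewrite GA. Qed.

Lemma coset_clopen_coset h : coset_clopen [set x | G (x - h)].
Proof.
by apply: coset_clopen_saturated => x v Gv /=; rewrite addrAC subgroup_addr.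
Qed.

(** Around each point [x + g] the set is locally constant; compactness of [G] turns these local
    radii into one radius for the whole coset. *)
Lemma clopen_coset_clopen A : clopen A -> coset_clopen A.
Proof.
move=> [oA cA] x.
have /compact_near_coveringP Gnc := compact_closed_span S_small p_prime p_tors.
have /nbhs_vnormP[d d0 dA] : nbhs (0 : X)
    (fun v => G `<=` (fun g => A (x + g + v) = A (x + g))).
  apply: Gnc => g Gg.
  have [e e0 ge] : exists2 e, 0 < e &
      forall u, vnorm u < e -> A (x + g + u) = A (x + g).
    have [Axg|nAxg] := pselect (A (x + g)).
      have /nbhs_vnormP[e e0 Ae] : nbhs (x + g) A by exact: open_nbhs_nbhs.
      exists e => // u ue; apply/propext; split=> // _; apply: Ae.
      by rewrite opprD addNKr vnormN.
    have /nbhs_vnormP[e e0 Ae] : nbhs (x + g) (~` A).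
      by apply: open_nbhs_nbhs; split=> //; exact: closed_openC.
    exists e => // u ue; apply/propext; split=> // ?; exfalso.
    by apply: (Ae (x + g + u)) => //; rewrite opprD addNKr vnormN.
  have ballx (y : X) : nbhs y [set z | vnorm (y - z) < e].
    by apply/nbhs_vnormP; exists e.
  exists ([set z | vnorm (g - z) < e], [set z | vnorm (0 - z) < e]).
    by split; exact: ballx.
  move=> [g' v] /= [gg' v0]; rewrite sub0r vnormN in v0.
  (* Both [x + g'] and [x + g' + v] lie in the ball around [x + g] on which membership in [A] is
     constant. *)
  have E : x + g' = x + g + (g' - g) by rewrite addrA addrAC addrK.
  have g'e : vnorm (g' - g) < e by rewrite vnormB.
  by rewrite E (ge (g' - g))// -addrA ge//; exact: vnormD_lt.
exists d => // g v Gg Gv vd.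
by apply: dA => //; rewrite sub0r vnormN.
Qed.

(** The members of [D] trace closed sets on the compact set [x + G]. *)
Lemma shrinking_coset (D : set (set X)) x : D `<=` coset_clopen ->
  shrinking D -> \bigcap_(A in D) A = set0 ->
  exists2 A, D A & forall g, G g -> ~ A (x + g).
Proof.
move=> DE sD D0; apply: contrapT => nD.
have DG A : D A -> exists2 g, G g & A (x + g).
  move=> DA; apply: contrapT => nA; apply: nD; exists A => // g Gg Axg.
  by apply: nA; exists g.
have [A0 DA0] : D !=set0.
  apply/set0P/eqP => De; move: D0; rewrite De bigcap_set0 => E.
  by have : [set: X] 0 by []; rewrite E.
(* The traces on [x + G], pulled back to [G], form a proper filter; a cluster point [z] of it will
   put [x + z] in every member of [D]. *)
pose f := filter_from D (fun A => [set g | G g /\ A (x + g)]).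
have fF : ProperFilter f.
  apply: filter_from_proper; last by move=> A /DG[g Gg Ag]; exists g.
  apply: filter_from_filter; first by exists A0.
  move=> A B DA DB; have [C DC CAB] := sD _ _ DA DB; exists C => //.
  by move=> g /= [Gg /CAB[]].
have [|z [Gz clz]] := compact_closed_span S_small p_prime p_tors fF.
  by exists A0 => // g [].
have : \bigcap_(A in D) A = set0 by [].
move=> /seteqP[/(_ (x + z))+ _]; apply => A DA.
have [e e0 xA] := DE _ DA x.
have [||g [[Gg Ag] /= gz]] := clz [set g | G g /\ A (x + g)]
    [set g | vnorm (z - g) < e]; first by exists A.
  by apply/nbhs_vnormP; exists e.
suff <- : A (x + z + (g - z)) = A (x + z) by rewrite addrA addrAC addrK.
by apply: xA => //; [exact: sG.2|rewrite vnormB].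
Qed.

Lemma coset_clopen_uniform A l : coset_clopen A ->
  {in l, forall w, exists m, G (w *+ p ^ m)} ->
  exists2 e, 0 < e & forall x v, ext l G x -> G v -> vnorm v < e ->
    A (x + v) = A x.
Proof.
move=> EA lG; have [w /lG[m mG]|r [_ rl]] := @ext_cosets X l G sG.
  by exists (p ^ m)%N; rewrite ?expn_gt0 ?prime_gt0.
have [e e0 re] : exists2 e, 0 < e & {in r, forall y, forall g v,
    G g -> G v -> vnorm v < e -> A (y + g + v) = A (y + g)}.
  elim: r {rl} => [|y r [e e0 re]]; first by exists 1.
  have [d d0 yd] := EA y; exists (Num.min e d); first by rewrite lt_min e0.
  move=> z; rewrite inE => zr g v Gg Gv; rewrite lt_min => /andP[ve vd].
  by case/predU1P: zr => [->|zr]; [exact: yd|exact: re].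
exists e => // x v /rl[y yr Gxy] Gv ve.
by have := re _ yr _ _ Gxy Gv ve; rewrite [y + _]addrC subrK.
Qed.

End coset_algebra.

(** * Haar measures *)

Section haar.
Context {R : realType} {X : CompleteUltraNormedZmod.type R}.
Context {F : valuedFieldType R} (p : nat).
Context (S : nat -> seq X).
Context (S_mono : forall m m', (m <= m')%N -> {subset S m <= S m'}).
Context (S_small : forall e : R, 0 < e ->
  exists N, forall m, {in S m, forall y, y \in S N \/ vnorm y < e}).
Context (p_prime : prime p).
Context (p_tors : forall (x : X) (e : R), 0 < e ->
  exists m, vnorm (x *+ p ^ m) < e).
Context (p_unit : vnorm (p%:R : F) = 1).
Implicit Types (x y : X) (e : R) (A B : set X) (l : seq X) (phi : X -> F).

Local Notation G := (closed_span S).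
Let sG : subgroup G := subgroup_closed_span S_small.

Let p_neq0 : p%:R != 0 :> F.
Proof. by rewrite -vnorm_eq0 p_unit oner_eq0. Qed.

Definition ind A x : F := `[< A x >]%:R.

Definition torsion_mod l := {in l, forall w, exists m, G (w *+ p ^ m)}.

Definition haar_avg l m phi := avgs p m (l ++ S m) phi.

(** The eventual value of the averages, by [haarP] ([0] if there is none). *)
Definition haar l A : F :=
  xget 0 [set v | exists M, forall m, (M <= m)%N -> haar_avg l m (ind A) 0 = v].

Lemma haar_gen l m : {in l ++ S m, forall y, ext l G y}.
Proof.
move=> y; rewrite mem_cat => /orP[yl|yS]; first exact: mem_ext.
by apply: sub_ext; exact: mem_closed_span yS.
Qed.

(** [haar_avg l m] and [haar_avg l M] commute, and each of them fixes the
functions invariant under [ext l G]. *)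
Lemma haar_avg_stable l phi e : torsion_mod l -> 0 < e ->
  (forall v, G v -> vnorm v < e -> periods phi v) ->
  exists M, forall m, (M <= m)%N -> ext l G `<=` periods (haar_avg l m phi) /\
    haar_avg l m phi = haar_avg l M phi.
Proof.
move=> tl e0 phie; have [N SN] := S_small e0.
have [M1 M1N] : exists M, forall m, (M <= m)%N ->
    {in S N, forall y, vnorm (y *+ p ^ m) < e}.
  by apply: list_uniform => y _; have := vnormMp_lt p_tors y e0.
have [M2 M2l] : exists M, forall m, (M <= m)%N ->
    {in l, forall w, G (w *+ p ^ m)}.
  apply: list_uniform => y /tl[M GM]; exists M => m Mm.
  by rewrite -(subnKC Mm) expnD mulrnA; exact: (subgroupMn _ sG).
pose M := maxn N (maxn M1 M2).
have inv m : (M <= m)%N -> ext l G `<=` periods (haar_avg l m phi).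
  rewrite !geq_max => /and3P[Nm M1m M2m].
  (* Only finitely many generators, those of [S N], are not yet periods of [phi]; for them [p ^ m]
     is large enough to make the [p ^ m]-th multiple a period, as [avgs_self] requires. *)
  have SG : G `<=` periods (avgs p m (S m) phi).
    apply: (closed_span_min S_small _ e0) => [|m' y ym'|v [Gv ve]].
    - exact: subgroup_periods.
    - have [yN|ye] := SN _ _ ym'; last first.
        by apply: avgs_periods; apply: phie => //; exact: mem_closed_span ym'.
      apply: (avgs_self p_neq0 _ (S_mono Nm yN)).
      move=> z zm; apply: phie.
        by apply: (subgroupMn _ sG); exact: mem_closed_span zm.
      have [/(M1N _ M1m)//|ze] := SN _ _ zm.
      by apply: le_lt_trans ze; exact: vnormMn_le.
    - by apply: avgs_periods; exact: phie.
  rewrite /haar_avg avgs_cat; apply: ext_min.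
  - exact: subgroup_periods.
  - by apply: (avgs_self p_neq0) => y /(M2l _ M2m)/SG.
  - by apply: subset_trans SG _; exact: avgs_periods.
exists M => m Mm; split; first exact: inv.
have fix_ m1 m2 : (M <= m1)%N ->
    haar_avg l m2 (haar_avg l m1 phi) = haar_avg l m1 phi.
  by move=> Mm1; apply: avgs_id => // y /haar_gen; exact: inv.
by rewrite -(fix_ m M) // /haar_avg avgsC -/(haar_avg _ _ _) fix_.
Qed.

(** The indicator of [A] has uniform small periods only on [ext l G]. Multiplying it by the
    indicator of [ext l G] makes them periods everywhere, and averages at points of [ext l G] do not
    see the change. *)
Lemma haarP l A : torsion_mod l -> coset_clopen S A ->
  exists M, forall m, (M <= m)%N -> forall x, ext l G x ->
    haar_avg l m (ind A) x = haar l A.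
Proof.
move=> tl EA; have sH := subgroup_ext l sG.
have [e e0 Ae] := coset_clopen_uniform S_small p_prime EA tl.
pose phi x := ind A x * ind (ext l G) x.
have phie v : G v -> vnorm v < e -> periods phi v.
  move=> Gv ve x; rewrite /phi /ind (subgroup_addr _ sH); last exact: sub_ext.
  have [Hx|nHx] := pselect (ext l G x); first by rewrite Ae.
  by rewrite (asboolF nHx) !mulr0.
have [M stab] := haar_avg_stable tl e0 phie.
have avgE m x : ext l G x -> haar_avg l m (ind A) x = haar_avg l m phi x.
  move=> Hx; apply: (avgs_local p m sH (@haar_gen l m)) => t Ht.
  rewrite /phi [ind (ext l G) _]/ind asboolT ?mulr1//.
  exact: subgroupD sH Hx Ht.
have H0 : ext l G 0 by exact: sH.1.
have E m : (M <= m)%N -> haar_avg l m (ind A) 0 = haar_avg l M phi 0.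
  by move=> Mm; rewrite avgE// (stab _ Mm).2.
have -> : haar l A = haar_avg l M phi 0.
  apply: xget_unique; first by exists M.
  move=> v [M' M'v]; rewrite -(M'v (maxn M M')) ?leq_maxr// E//.
  exact: leq_maxl.
exists M => m Mm x Hx; rewrite avgE// -[x]add0r (stab _ Mm).1//.
by rewrite (stab _ Mm).2.
Qed.

Lemma indU A B x : A `&` B = set0 -> ind (A `|` B) x = ind A x + ind B x.
Proof.
move=> AB0; rewrite /ind /setU /= asbool_or.
have [Ax|nAx] := pselect (A x); last by rewrite (asboolF nAx) add0r.
rewrite asboolT// asboolF ?addr0// => Bx.
by have : (A `&` B) x by []; rewrite AB0.
Qed.

Lemma haarU l A B : torsion_mod l -> coset_clopen S A -> coset_clopen S B ->
  A `&` B = set0 -> haar l (A `|` B) = haar l A + haar l B.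
Proof.
move=> tl EA EB AB0; have [M1 E1] := haarP tl EA; have [M2 E2] := haarP tl EB.
have [M3 E3] := haarP tl (coset_clopenU EA EB).
have H0 : ext l G 0 by exact: (subgroup_ext l sG).1.
pose M := maxn M1 (maxn M2 M3).
rewrite -(E1 M _ 0) -?(E2 M _ 0) -?(E3 M _ 0)// ?leq_max ?leqnn ?orbT//.
rewrite /haar_avg -avgsD; congr (avgs _ _ _ _ _); apply/funext => x.
exact: indU.
Qed.

Lemma haar_le1 l A : torsion_mod l -> coset_clopen S A -> vnorm (haar l A) <= 1.
Proof.
move=> tl EA; have [M E] := haarP tl EA.
rewrite -(E M _ 0)//; last exact: (subgroup_ext l sG).1.
apply: vnorm_avgs => // y; rewrite /ind; exact: vnorm_nat_le1.
Qed.

Lemma haar_eq0 l A : torsion_mod l -> coset_clopen S A ->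
  A `&` ext l G = set0 -> haar l A = 0.
Proof.
move=> tl EA A0; have [M E] := haarP tl EA; have sH := subgroup_ext l sG.
have H0 : ext l G 0 by exact: sH.1.
rewrite -(E M _ 0)// /haar_avg.
rewrite (@avgs_local _ _ _ _ _ _ _ (fun=> 0) _ sH (@haar_gen l M)).
  by rewrite avgs_cst.
move=> t Ht; rewrite add0r /ind asboolF// => At.
by have : (A `&` ext l G) t by []; rewrite A0.
Qed.

Lemma haar_sub1 l A : torsion_mod l -> coset_clopen S A ->
  ext l G `<=` A -> haar l A = 1.
Proof.
move=> tl EA HA; have [M E] := haarP tl EA; have sH := subgroup_ext l sG.
have H0 : ext l G 0 by exact: sH.1.
rewrite -(E M _ 0)// /haar_avg.
rewrite (@avgs_local _ _ _ _ _ _ _ (fun=> 1) _ sH (@haar_gen l M)).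
  by rewrite avgs_cst.
by move=> t Ht; rewrite add0r /ind asboolT//; exact: HA.
Qed.

Lemma haar_shift l A a : torsion_mod l -> coset_clopen S A -> ext l G a ->
  haar l [set x | A (x + a)] = haar l A.
Proof.
move=> tl EA Ha; have [M1 E1] := haarP tl EA.
have [M2 E2] := haarP tl (coset_clopen_shift a EA).
have H0 : ext l G 0 by exact: (subgroup_ext l sG).1.
pose M := maxn M1 M2.
rewrite -(E1 M _ a) -?(E2 M _ 0)// ?leq_max ?leqnn ?orbT//.
by rewrite /haar_avg -[in RHS](add0r a) -avgs_shift.
Qed.

(** Averaging over the generators of [G] first turns the indicator of [A] into a constant multiple
    of the indicator of the coset. The constant is independent of [l]: inside one coset all these
    measures are proportional to Haar measure of [G]. *)
Lemma haar_coset_mul l A h : torsion_mod l -> coset_clopen S A ->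
  A `<=` [set x | G (x - h)] ->
  haar l A = haar [::] [set x | A (x + h)] * haar l [set x | G (x - h)].
Proof.
move=> tl EA AG; have EA' := coset_clopen_shift h EA.
have t0 : torsion_mod [::] by [].
have EG := coset_clopen_coset S_small h.
have [M1 E1] := haarP tl EA; have [M2 E2] := haarP t0 EA'.
have [M3 E3] := haarP tl EG.
have H0 : ext l G 0 by exact: (subgroup_ext l sG).1.
pose M := maxn M1 (maxn M2 M3).
rewrite -(E1 M _ 0) -?(E3 M _ 0)// ?leq_max ?leqnn ?orbT//.
rewrite /haar_avg avgs_cat.
suff -> : avgs p M (S M) (ind A) =
    (fun x => haar [::] [set x | A (x + h)] * ind [set x | G (x - h)] x).
  rewrite avgsZ avgs_cat; congr (_ * avgs _ _ _ _ _).
  rewrite avgs_id// => y yM x; rewrite /ind /= addrAC (subgroup_addr _ sG)//.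
  exact: mem_closed_span yM.
apply/funext => x; rewrite {2}/ind /=.
have [Gx|nGx] := pselect (G (x - h)).
  rewrite asboolT// mulr1 -(E2 M _ (x - h))// ?leq_max ?leqnn ?orbT//.
  rewrite /haar_avg /= -{1}[x](subrK h) -avgs_shift.
  by congr (avgs _ _ _ _ _).
rewrite asboolF// mulr0.
rewrite (@avgs_local _ _ _ _ _ _ _ (fun=> 0) _ sG); first by rewrite avgs_cst.
  by move=> y; exact: mem_closed_span.
move=> t Gt; rewrite /ind asboolF// => /AG/=.
by rewrite addrAC (subgroup_addr _ sG).
Qed.

Lemma haar_coset l h : torsion_mod l -> ext l G h ->
  haar l [set x | G (x - h)] = haar l G.
Proof.
move=> tl Hh; have EG := coset_clopen_coset S_small 0.
have -> : G = [set x | G (x - 0)].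
  by apply/funext => x /=; rewrite subr0.
rewrite -(haar_shift tl EG (a := - h)) /=; last first.
  by apply: subgroupN => //; exact: subgroup_ext.
by congr (haar l _); apply/funext => x /=; rewrite !subr0.
Qed.

(** The integer [k] counts the cosets of [G] in [ext l G] that lie in [A]; all of them have the same
    measure. *)
Lemma haar_saturated l A : torsion_mod l ->
  (forall x v, G v -> A (x + v) = A x) ->
  exists k : nat, haar l A = k%:R * haar l G.
Proof.
move=> tl GA; have [w /tl[m mG]|r [rH rl]] := @ext_cosets X l G sG.
  by exists (p ^ m)%N; rewrite ?expn_gt0 ?prime_gt0.
pose U (r : seq X) : set X := [set x | exists2 y, y \in r & G (x - y)].
have satU r' x v : G v -> U r' (x + v) = U r' x.
  move=> Gv; apply/propext; rewrite /U /=.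
  by split=> -[y yr Gy]; exists y => //; move: Gy;
    rewrite addrAC (subgroup_addr _ sG Gv).
have EA := coset_clopen_saturated GA.
have EU r' := coset_clopen_saturated (@satU r').
(* The cosets of [r] cover [ext l G], outside of which the measure vanishes; induction on [r] then
   adds one coset at a time. *)
have -> : haar l A = haar l (A `&` U r).
  rewrite -[in LHS](setIT A) -(setUCr (U r)) setIUr haarU//.
  - rewrite [X in _ + X]haar_eq0 ?addr0//.
      by apply: coset_clopenI => //; exact: coset_clopenC.
    rewrite -subset0 => x [[_ nUx] Hx]; apply: nUx.
    exact: rl.
  - exact: coset_clopenI.
  - by apply: coset_clopenI => //; exact: coset_clopenC.
  - by rewrite setIACA setICr setI0.
elim: r {rl} rH => [|y r IH] rH.
  exists 0%N; rewrite mul0r haar_eq0//.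
    exact: coset_clopenI.
  by rewrite -subset0 => x [[_ [y]]].
have [k IHk] := IH (fun z zr => rH z (@mem_behead _ (y :: r) z zr)).
have Uy : U (y :: r) = U r `|` [set x | G (x - y)].
  apply/funext => x; apply/propext; split=> [[z]|[[z zr Gz]|Gxy]].
  - by rewrite inE => /predU1P[->|zr Gz]; [right|left; exists z].
  - by exists z; rewrite ?inE ?zr ?orbT.
  - by exists y; rewrite ?mem_head.
have satG x v : G v -> G (x + v - y) = G (x - y).
  by move=> Gv; rewrite addrAC (subgroup_addr _ sG).
rewrite Uy.
have trans x : G (x - y) -> forall B : set X,
    (forall x v, G v -> B (x + v) = B x) -> B x = B y.
  by move=> Gxy B satB; rewrite -(satB y _ Gxy) addrC subrK.
(* If the coset of [y] misses [A] or is already listed, the count is unchanged; otherwise it lies in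
   [A] and is disjoint from the earlier ones. *)
have [[Ay nUy]|nAU] := pselect (A y /\ ~ U r y); last first.
  exists k; rewrite -IHk; congr (haar l _); apply/funext => x; apply/propext.
  split=> [[Ax [Ux|Gx]]|[Ax Ux]]; [by []| |by split=> //; left].
  split=> //; apply: contrapT => nUx; apply: nAU.
  by rewrite -(trans x Gx A GA) -(trans x Gx _ (@satU r)).
exists k.+1; rewrite setIUr.
have -> : A `&` [set x | G (x - y)] = [set x | G (x - y)].
  by apply/seteqP; split=> [x []//|x Gx]; split=> //; rewrite (trans x Gx A GA).
rewrite haarU//.
- rewrite IHk haar_coset ?mulrSr ?mulrDl ?mul1r//.
  by apply: rH; rewrite mem_head.
- exact: coset_clopenI.
- exact: coset_clopen_coset.
- rewrite -subset0 => x [[_ Ux] Gx]; apply: nUy.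
  by rewrite -(trans x Gx _ (@satU r)).
Qed.

(** [1 = haar l X = k * haar l G] with [k] an integer, and both factors have
norm at most [1]. *)
Lemma vnorm_haar_coset l h : torsion_mod l -> ext l G h ->
  vnorm (haar l [set x | G (x - h)]) = 1.
Proof.
move=> tl Hh; rewrite haar_coset//.
have ET : coset_clopen S setT by exact: coset_clopen_saturated.
have EG : coset_clopen S G.
  by apply: coset_clopen_saturated => x v Gv; rewrite (subgroup_addr _ sG).
have [//|k k1] := @haar_saturated l setT tl.
rewrite haar_sub1// in k1.
have := vnorm1 (F := F); rewrite k1 vnormM => kG.
apply/eqP; rewrite eq_le haar_le1//= -[leLHS]kG.
by rewrite ler_piMl ?vnorm_ge0// vnorm_nat_le1.
Qed.

End haar.

(** * The measure and its densities *)

Lemma exists_expr_lt {R : realType} (x e : R) : 0 <= x -> x < 1 -> 0 < e ->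
  exists N, x ^+ N < e.
Proof.
rewrite le_eqVlt => /predU1P[<-|x0] x1 e0.
  by exists 1%N; rewrite expr1.
have d0 : 0 < x^-1 - 1 by rewrite subr_gt0 invf_gt1.
(* A form of Bernoulli's inequality, which makes the powers of [x^-1] unbounded. *)
have bern n : n%:R * (x^-1 - 1) <= x^-1 ^+ n.
  elim: n => [|n IH]; first by rewrite mul0r expr0 ler01.
  rewrite exprS -[X in X * _ ^+ _](subrK 1) mulrDl mul1r.
  rewrite -natr1 mulrDl mul1r addrC lerD// ler_peMr ?(ltW d0)//.
  by rewrite exprn_ege1// invf_ge1// ltW.
pose N := Num.bound (e^-1 / (x^-1 - 1)).
have := archi_boundP (x := e^-1 / (x^-1 - 1)).
rewrite divr_ge0 ?invr_ge0 ?(ltW e0) ?(ltW d0)// => /(_ isT).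
rewrite -/N ltr_pdivrMr// => /lt_le_trans/(_ (bern N)).
by rewrite exprVn ltf_pV2 ?posrE ?exprn_gt0// => ?; exists N.
Qed.

(** * Series in powers of [s] over the [s]-adic numbers *)

Section series.
Context {R : realType} {s : nat} {Q : padicFieldType R s}.
Context (s_prime : prime s).
Implicit Types (a b : nat -> Q) (c : Q).

Lemma vnorm_padic_nat n : (0 < n)%N -> coprime n s ->
  vnorm (n%:R : Q) = 1.
Proof.
move=> n0 ns; rewrite -[X in vnorm X]ratr_nat vnorm_ratr /padic_abs pnatr_eq0.
rewrite (pmulrn (1 : rat) n) numq_int denq_int gtn_eqF// absz_nat logn1 expr0.
by rewrite logn_coprime ?expr0 ?divr1// coprime_sym.
Qed.

Lemma vnorm_padic_s : vnorm (s%:R : Q) = s%:R^-1.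
Proof.
rewrite -[X in vnorm X]ratr_nat vnorm_ratr /padic_abs pnatr_eq0.
rewrite (pmulrn (1 : rat) s) numq_int denq_int.
rewrite absz_nat logn1 expr0 gtn_eqF ?prime_gt0// logn_prime// eqxx expr1.
by rewrite div1r.
Qed.

Local Notation t := (s%:R : Q).

Lemma vnorm_t_lt1 : vnorm t < 1.
Proof.
by rewrite vnorm_padic_s invf_lt1 ?ltr1n ?ltr0n ?prime_gt0 ?prime_gt1.
Qed.

Lemma vnorm_t_gt0 : 0 < vnorm t.
Proof. by rewrite vnorm_padic_s invr_gt0 ltr0n prime_gt0. Qed.

Lemma vnorm_1Bt : vnorm (1 - t) = 1.
Proof.
apply/eqP; rewrite eq_le; apply/andP; split.
  by apply: vnormB_le; rewrite ?vnorm1// ltW ?vnorm_t_lt1.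
rewrite leNgt; apply/negP => lt1.
have := vnormD_lt lt1 vnorm_t_lt1.
by rewrite subrK vnorm1 ltxx.
Qed.

Definition partial a N : Q := \sum_(i < N) t ^+ i * a i.

(** The sum of the series of the [t ^+ i * a i], characterized by its rate of
convergence when the [a i] are integral ([0] if there is no such sum). *)
Definition ser a : Q :=
  xget 0 [set v | forall N, vnorm (v - partial a N) <= vnorm t ^+ N].

Lemma partial_tail a N m : (forall i, vnorm (a i) <= 1) -> (N <= m)%N ->
  vnorm (partial a m - partial a N) <= vnorm t ^+ N.
Proof.
move=> a1 /subnKC <-; elim: (m - N)%N => [|k IH].
  by rewrite addn0 subrr vnorm0 exprn_ge0 ?vnorm_ge0.
rewrite addnS /partial big_ord_recr /= addrAC; apply: vnormD_le => //.
rewrite vnormM vnormX exprD -mulrA ler_piMr ?exprn_ge0 ?vnorm_ge0//.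
rewrite mulr_ile1 ?exprn_ge0 ?vnorm_ge0//.
by rewrite exprn_ile1 ?vnorm_ge0 ?ltW ?vnorm_t_lt1.
Qed.

Lemma ser_unique a v :
  (forall N, vnorm (v - partial a N) <= vnorm t ^+ N) -> ser a = v.
Proof.
move=> va; apply: xget_unique => // w wa; apply: contrapT => /eqP wv.
have d0 : 0 < vnorm (w - v).
  by rewrite lt_neqAle vnorm_ge0 andbT eq_sym vnorm_eq0 subr_eq0.
have [N] := exists_expr_lt (vnorm_ge0 _) vnorm_t_lt1 d0.
rewrite ltNge => /negP; apply.
have -> : w - v = (w - partial a N) - (v - partial a N).
  by rewrite opprB addrA subrK.
exact: vnormB_le.
Qed.

Lemma serP a : (forall i, vnorm (a i) <= 1) ->
  forall N, vnorm (ser a - partial a N) <= vnorm t ^+ N.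
Proof.
move=> a1.
suff [v va] : exists v, forall N, vnorm (v - partial a N) <= vnorm t ^+ N.
  by rewrite (ser_unique va).
have cau : cauchy_ex (partial a n @[n --> \oo]).
  move=> e e0; have [N Ne] := exists_expr_lt (vnorm_ge0 _) vnorm_t_lt1 e0.
  exists (partial a N); exists N => // m /= Nm.
  rewrite vnorm_ballE /ball_ /= vnormB; apply: le_lt_trans Ne.
  exact: partial_tail.
have : cvg (partial a n @[n --> \oo]).
  by apply: cauchy_cvg; exact: cauchy_exP cau.
move=> /cvg_vnormP lima; exists (lim (partial a n @[n --> \oo])) => N.
have tN : 0 < vnorm t ^+ N by rewrite exprn_gt0// vnorm_t_gt0.
(* An index beyond both [M] and [N] makes the limit close to a partial sum to which [partial_tail]
   applies. *)
have [M _ /(_ (maxn M N))/=] := lima _ tN; rewrite leq_maxl => /(_ isT) lM.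
rewrite -[lim _](subrK (partial a (maxn M N))) -addrA.
by apply: vnormD_le (ltW lM) _; apply: partial_tail => //; rewrite leq_maxr.
Qed.

Lemma serD a b : (forall i, vnorm (a i) <= 1) -> (forall i, vnorm (b i) <= 1) ->
  ser (fun i => a i + b i) = ser a + ser b.
Proof.
move=> a1 b1; apply: ser_unique => N.
have -> : partial (fun i => a i + b i) N = partial a N + partial b N.
  by rewrite /partial -big_split; apply: eq_bigr => i _; rewrite mulrDr.
by rewrite opprD addrACA; apply: vnormD_le; exact: serP.
Qed.

Lemma serZ c a : vnorm c <= 1 -> (forall i, vnorm (a i) <= 1) ->
  ser (fun i => c * a i) = c * ser a.
Proof.
move=> c1 a1; apply: ser_unique => N.
have -> : partial (fun i => c * a i) N = c * partial a N.
  by rewrite /partial mulr_sumr; apply: eq_bigr => i _; rewrite mulrCA.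
rewrite -mulrBr vnormM -[leRHS]mul1r.
by apply: ler_pM; rewrite ?vnorm_ge0//; exact: serP.
Qed.

Lemma ser_le a N : (forall i, vnorm (a i) <= 1) ->
  (forall i, (i < N)%N -> a i = 0) -> vnorm (ser a) <= vnorm t ^+ N.
Proof.
move=> a1 a0; have := serP a1 N; rewrite /partial big1 ?subr0// => i _.
by rewrite a0// mulr0.
Qed.

(** The first nonzero term has norm [|t|^N], while all that follows has norm at most [|t|^(N+1)] and
    cannot cancel it. *)
Lemma ser_neq0 a N : (forall i, vnorm (a i) <= 1) ->
  (forall i, (i < N)%N -> a i = 0) -> vnorm (a N) = 1 -> ser a != 0.
Proof.
move=> a1 a0 aN; apply/eqP => ser0.
have := serP a1 N.+1; rewrite ser0 sub0r vnormN /partial big_ord_recr big1 /=.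
  rewrite add0r vnormM vnormX aN mulr1 exprS leNgt gtr_pMl ?vnorm_t_lt1//.
  by rewrite exprn_gt0// vnorm_t_gt0.
by move=> i _; rewrite a0// mulr0.
Qed.

(** Geometric series: its remainder [t^N / (1 - t)] has norm exactly [|t|^N], since [1 - t] has norm
    1. *)
Lemma ser1 : (1 - t) * ser (fun=> 1) = 1.
Proof.
have nz : 1 - t != 0 by rewrite -vnorm_eq0 vnorm_1Bt oner_eq0.
have -> : ser (fun=> 1) = (1 - t)^-1; last by rewrite divff.
apply: ser_unique => N; rewrite -[leLHS]mul1r -[X in X * _]vnorm_1Bt -vnormM.
rewrite mulrBr divff// -[1 - t]opprB mulNr opprK.
under [partial _ _]eq_bigr do rewrite mulr1.
by rewrite -subrX1 addrC subrK vnormX.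
Qed.

End series.

Section measure.
Context {R : realType} {K : valuedFieldType R} {X : ultraBanachType K}.
Context {p s : nat} {Q : padicFieldType R s} {L : valuedFieldExtType Q}.
Context (p_prime : prime p) (s_prime : prime s) (neq_sp : s != p).
Context (S W : nat -> seq X).
Context (S_mono : forall m m', (m <= m')%N -> {subset S m <= S m'}).
Context (S_small : forall e : R, 0 < e ->
  exists N, forall m, {in S m, forall y, y \in S N \/ vnorm y < e}).
Context (p_tors : forall (x : X) (e : R), 0 < e ->
  exists m, vnorm (x *+ p ^ m) < e).
Context (W_mono : forall m m', (m <= m')%N -> {subset W m <= W m'}).
Context (W_tors : forall n, torsion_mod p S (W n)).
Implicit Types (x a h : X) (A B : set X) (n m : nat).

Local Notation G := (closed_span S).
Local Notation H n := (ext (W n) (closed_span S)).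
Local Notation t := (s%:R : Q).
Local Notation hr n A := (haar (F := Q) p S (W n) A).

Let sG : subgroup G := subgroup_closed_span S_small.
Let sH n : subgroup (H n) := subgroup_ext (W n) sG.
Let H_mono n m : (n <= m)%N -> H n `<=` H m.
Proof. by move=> nm; apply: extS => //; exact: W_mono. Qed.

Let p_unit : vnorm (p%:R : Q) = 1.
Proof.
apply: vnorm_padic_nat; first exact: prime_gt0.
by rewrite prime_coprime// dvdn_prime2// eq_sym.
Qed.

Definition muq A : Q := (1 - t) * ser (fun n => hr n A).

(** The series is summed in the complete field [Q] and only its value is carried to [L], by an
    isometric embedding. *)
Definition mu A : L := (muq A)%:A.

Let hr1 A n : coset_clopen S A -> vnorm (hr n A) <= 1.
Proof. by move=> EA; exact: (haar_le1 S_mono S_small). Qed.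

Lemma vnorm_mu A : vnorm (mu A) = vnorm (ser (fun n => hr n A)).
Proof. by rewrite /mu vnorm_in_alg vnormM vnorm_1Bt// mul1r. Qed.

Lemma muU A B : coset_clopen S A -> coset_clopen S B -> A `&` B = set0 ->
  mu (A `|` B) = mu A + mu B.
Proof.
move=> EA EB AB0; rewrite /mu -scalerDl /muq -mulrDr.
rewrite -serD//; do ?by move=> i; exact: hr1.
by congr (_ * ser _ *: _); apply/funext => n; exact: (haarU S_mono S_small).
Qed.

Lemma mu_le1 A : coset_clopen S A -> vnorm (mu A) <= 1.
Proof.
move=> EA; rewrite vnorm_mu -[leRHS](expr0 (vnorm t)).
by apply: ser_le => // i; exact: hr1.
Qed.

(** As the groups [H n] increase, [A] misses all those of index below [N], and the first [N] terms
    of the series vanish. *)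
Lemma mu_small A N : coset_clopen S A -> A `&` H N = set0 ->
  vnorm (mu A) <= vnorm t ^+ N.
Proof.
move=> EA AN; rewrite vnorm_mu; apply: ser_le => // i; first exact: hr1.
move=> iN; apply: (haar_eq0 S_mono S_small) => //.
by rewrite -subset0 -AN => x [Ax /(H_mono (ltnW iN))].
Qed.

Lemma muT : mu setT = 1.
Proof.
have ET : coset_clopen S setT by exact: coset_clopen_saturated.
rewrite /mu /muq (_ : (fun n => _) = (fun=> 1)) ?ser1 ?scale1r//.
by apply/funext => n; exact: (haar_sub1 S_mono S_small).
Qed.

Lemma mu0 : mu set0 = 0.
Proof.
have E0 : coset_clopen S set0 by exact: coset_clopen_saturated.
by have := muU E0 E0 (setI0 _); rewrite setU0 => /eqP; rewrite -subr_eq0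
  opprD addrA subrr add0r oppr_eq0 => /eqP.
Qed.

Lemma is_measure_mu : is_measure (coset_clopen S) mu.
Proof.
split.
- exact: coset_clopen_saturated.
- exact: coset_clopenU.
- exact: coset_clopenC.
- by move=> A; exact: (clopen_coset_clopen S_small p_prime p_tors).
- exact: mu0.
- exact: muU.
- by move=> A EA; exists 1 => _ [B [EB _] <-]; exact: mu_le1.
- move=> D DE sD D0.
  have [A0 DA0] : D !=set0.
    apply/set0P/eqP => De; move: D0; rewrite De bigcap_set0 => E.
    by have : [set: X] 0 by []; rewrite E.
  have FD : Filter (shrinking_filter D).
    apply: filter_from_filter; first by exists A0.
    move=> A B DA DB; have [C DC CAB] := sD _ _ DA DB; exists C => //.
    by move=> B' /= [DB' B'C]; split; split=> // x /B'C/CAB[].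
  apply/cvg_vnormP => e e0.
  (* A set disjoint from [H N] has measure of norm below [e]. Since [H N] is a finite union of
     cosets of [G], a member of [D] missing all of them is found by avoiding one coset at a time. *)
  have [N Ne] := exists_expr_lt (vnorm_ge0 _) (vnorm_t_lt1 s_prime (Q := Q)) e0.
  have [w /W_tors[m mG]|r [_ rN]] := @ext_cosets X (W N) G sG.
    by exists (p ^ m)%N; rewrite ?expn_gt0 ?prime_gt0.
  have [C DC Cr] : exists2 C, D C &
      {in r, forall y g, G g -> ~ C (y + g)}.
    elim: r {rN} => [|y r [C DC Cr]]; first by exists A0.
    have [A DA Ay] := shrinking_coset S_small p_prime p_tors y DE sD D0.
    have [B DB BAC] := sD _ _ DA DC; exists B => // z.
    rewrite inE => /predU1P[->|zr] g Gg /BAC[]; first by move=> /Ay.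
    by move=> _; exact: Cr.
  exists C => // B [DB BC] /=; rewrite sub0r vnormN; apply: le_lt_trans Ne.
  apply: mu_small; first exact: DE.
  rewrite -subset0 => x [/BC Cx /rN[y yr Gxy]].
  by apply: (Cr _ yr _ Gxy); rewrite addrC subrK.
Qed.

Lemma is_probability_mu : is_probability (coset_clopen S) mu.
Proof.
split; last exact: muT.
have ET : coset_clopen S setT by exact: coset_clopen_saturated.
have v1 : measure_values (coset_clopen S) mu setT 1.
  by exists setT => //=; rewrite muT vnorm1.
have ub1 : ubound (measure_values (coset_clopen S) mu setT) 1.
  by move=> _ [B [EB _] <-]; exact: mu_le1.
apply/eqP; rewrite eq_le; apply/andP; split.
  by apply: ge_sup => //; exists 1.
by apply: ub_le_sup => //; exists 1.
Qed.

(** * The density of a translate with respect to the measure *)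

Section density.
Context (M : nat) (a : X) (Ha : H M a).

Local Notation cos h := [set z | G (z - h)].
Local Notation sh A := [set x | A (x + a)].

(** Terms of index above [M] are invariant under [a]. The others vanish on both sides, because [H M]
    is stable under translation by [a]. *)
Lemma mu_shift_outside A : coset_clopen S A -> A `&` H M = set0 ->
  mu (sh A) = mu A.
Proof.
move=> EA AM; congr ((_ * ser _) *: _); apply/funext => n.
have [nM|/ltnW Mn] := leqP n M; last first.
  by apply: (haar_shift S_mono S_small) => //; exact: H_mono Ha.
rewrite !(haar_eq0 S_mono S_small)//.
- by rewrite -subset0 -AM => x [Ax /(H_mono nM)].
- exact: coset_clopen_shift.
- rewrite -subset0 => x [/= Ax /(H_mono nM) Hx].
  suff : (A `&` H M) (x + a) by rewrite AM.
  by split=> //; exact: (subgroupD (sH M)).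
Qed.

Lemma mu_coset A h : coset_clopen S A -> A `<=` cos h ->
  mu A = (haar (F := Q) p S [::] [set x | A (x + h)])%:A * mu (cos h).
Proof.
move=> EA Ah; have EC := coset_clopen_coset S_small h.
rewrite /mu mulr_algl scalerA /muq mulrCA -[haar _ _ _ _ * ser _]serZ//.
- congr ((_ * ser _) *: _); apply/funext => n.
  by apply: (haar_coset_mul S_mono S_small).
- by apply: (haar_le1 S_mono S_small) => //; exact: coset_clopen_shift.
- by move=> i; exact: hr1.
Qed.

(** Let [N] be the first index with [h] in [H N]. The coset misses all earlier groups, and its Haar
    measure in [H N] has norm 1, so the series starts with a term that cannot be cancelled. *)
Lemma mu_coset_neq0 n h : H n h -> mu (cos h) != 0.
Proof.
move=> Hh; have EC := coset_clopen_coset S_small h.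
rewrite -vnorm_eq0 vnorm_mu vnorm_eq0.
have ex : exists n, `[< H n h >] by exists n; exact/asboolP.
case: (ex_minnP ex) => N /asboolP HN minN.
apply: (@ser_neq0 _ _ _ s_prime _ N) => [i|i iN|]; first exact: hr1.
  apply: (haar_eq0 S_mono S_small) => //.
  rewrite -subset0 => x [/= Gxh Hx].
  suff /asboolP/minN : H i h by rewrite leqNgt iN.
  rewrite -(subgroup_subr h (sH i) Hx) -opprB; apply: (subgroupN (sH i)).
  exact: sub_ext.
exact: (vnorm_haar_coset S_mono S_small).
Qed.

(** Translation carries the coset of [x] to that of [x - a], and on both [mu] is a multiple of Haar
    measure of [G]; the quotient compares the two factors. *)
Definition density x : L :=
  if `[< H M x >] then mu (cos (x - a)) / mu (cos x) else 1.

Lemma density_saturated x v : G v -> density (x + v) = density x.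
Proof.
move=> Gv; have cosE y : cos (y + v) = cos y.
  by apply/funext => z /=; rewrite opprD addrA (subgroup_subr _ sG Gv).
rewrite /density (subgroup_addr _ (sH M)); last exact: sub_ext.
by rewrite [x + v - a]addrAC !cosE.
Qed.


Lemma density_cosets : exists r : seq X, {in r, forall y, H M y} /\
  forall x, H M x -> exists2 y, y \in r & G (x - y).
Proof.
apply: ext_cosets => // w /W_tors[m mG].
by exists (p ^ m)%N; rewrite ?expn_gt0 ?prime_gt0.
Qed.

Lemma density_coset x y : G (x - y) -> density x = density y.
Proof. by move=> Gxy; rewrite -[x](subrK y) addrC density_saturated. Qed.

(** Induction on a list of cosets covering the part of [A] in [H M]: each coset is split off and
    treated by proportionality, and what lies outside [H M] keeps its measure. *)
Lemma mu_density A v : coset_clopen S A -> A `<=` density @^-1` [set v] ->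
  mu (sh A) = v * mu A.
Proof.
have [r [rH rM]] := density_cosets.
have {rM} : A `&` H M `<=` [set x | exists2 y, y \in r & G (x - y)].
  by move=> x [_ /rM].
elim: r rH A => [|y r IH] rH A Ar EA Av.
  have AM : A `&` H M = set0 by rewrite -subset0 => x /Ar[].
  rewrite mu_shift_outside//.
  (* A point of [A] is needed to learn that [v = 1]; for empty [A] the value [v] is arbitrary and
     both sides are 0. *)
  have [->|/set0P[x Ax]] := eqVneq A set0; first by rewrite mu0 mulr0.
  rewrite -(Av x Ax) /density asboolF ?mul1r// => Hx.
  by have : (A `&` H M) x by []; rewrite AM.
have Hy : H M y by apply: rH; rewrite mem_head.
have EC := coset_clopen_coset S_small y.
have EAC := coset_clopen_shift a (coset_clopenI EA EC).
have EAD := coset_clopen_shift a (coset_clopenI EA (coset_clopenC EC)).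
have AE : A = (A `&` cos y) `|` (A `&` ~` cos y).
  by rewrite -setIUr setUCr setIT.
have A0 : (A `&` cos y) `&` (A `&` ~` cos y) = set0.
  by rewrite setIACA setICr setI0.
rewrite AE muU//; [|exact: coset_clopenI|]; last first.
  by apply: coset_clopenI => //; exact: coset_clopenC.
rewrite -[sh _]/(sh (A `&` cos y) `|` sh (A `&` ~` cos y)) muU//; last first.
  rewrite -subset0 => x Ax.
  by have : ((A `&` cos y) `&` (A `&` ~` cos y)) (x + a) by []; rewrite A0.
rewrite mulrDr; congr (_ + _); last first.
  apply: IH => [z zr|x [[Ax nGx] Hx]||x [/Av]//].
  - by apply: rH; rewrite inE zr orbT.
  - have [|z] := Ar x; first by [].
    by rewrite inE => /predU1P[->//|zr Gz]; exists z.
  - by apply: coset_clopenI => //; exact: coset_clopenC.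
have [AC0|/set0P[x [Ax Gx]]] := eqVneq (A `&` cos y) set0.
  by rewrite AC0 -[sh set0]/(set0 : set X) mu0 mulr0.
have -> : v = mu (cos (y - a)) / mu (cos y).
  by rewrite -(Av x Ax) (density_coset Gx) /density asboolT.
(* Recentred at [y - a] and at [y] respectively, the translated and the original piece become the
   same subset of [G], so their Haar factors coincide. *)
rewrite (mu_coset (h := y - a) EAC); last first.
  by move=> z [_ /=]; rewrite opprB addrA addrAC.
rewrite (mu_coset (h := y) (coset_clopenI EA EC)) //.
rewrite [RHS]mulrCA divfK; last exact: mu_coset_neq0 Hy.
congr (_ %:A * _); congr (haar _ _ _ _).
by apply/funext => z /=; rewrite addrA subrK.
Qed.

Lemma finite_range_density : finite_set (range density).
Proof.
have [r [_ rM]] := density_cosets.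
apply: (@sub_finite_set _ _ [set` 1 :: [seq density y | y <- r]]).
  move=> _ [x _ <-] /=; rewrite inE; have [Hx|nHx] := pselect (H M x).
    have [y yr Gxy] := rM x Hx; apply/orP; right.
    by rewrite (density_coset Gxy) map_f.
  by rewrite /density asboolF// eqxx.
exact: finite_seq.
Qed.

Lemma mu_range (A : set X) (r : seq L) : coset_clopen S A ->
  (forall v, coset_clopen S (density @^-1` [set v])) -> uniq r ->
  \sum_(v <- r) v * mu (A `&` density @^-1` [set v]) =
  mu (sh (A `&` density @^-1` [set` r])).
Proof.
move=> EA Ev; elim: r => [_|v r IH /= /andP[vr ur]].
  rewrite big_nil -[LHS]mu0; congr mu; apply/esym; rewrite -subset0.
  by move=> x [].
have Er : coset_clopen S (density @^-1` [set` r]).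
  apply: coset_clopen_saturated => x w Gw.
  by rewrite /preimage /= density_saturated.
rewrite big_cons IH// -(mu_density (v := v)); last 2 first.
- exact: coset_clopenI.
- by move=> x [].
rewrite -muU.
- congr mu; apply/funext => x; apply/propext; split=> /=.
    move=> [[Ax dx]|[Ax dx]]; split=> //.
      by rewrite /= inE dx eqxx.
    by rewrite /= inE dx orbT.
  by move=> [Ax]; rewrite /= inE => /predU1P[dx|dx]; [left|right].
- by apply: coset_clopen_shift; exact: coset_clopenI.
- by apply: coset_clopen_shift; exact: coset_clopenI.
- rewrite -subset0 => x [[_ dx] [_ /= dr]]; move: vr.
  by rewrite -dx dr.
Qed.

Lemma admissible_shift : admissible_shifts (coset_clopen S) mu a.
Proof.
have Ev v : coset_clopen S (density @^-1` [set v]).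
  apply: coset_clopen_saturated => x w Gw.
  by rewrite /preimage /= density_saturated.
have sd : simple_fun (coset_clopen S) density.
  by split=> //; exact: finite_range_density.
(* The density is itself simple, so a constant sequence approximates it and its integral is a finite
   sum. *)
have ap : simple_approx (coset_clopen S) mu density (fun=> density).
  split=> //; rewrite (_ : measure_seminorm _ _ _ = 0%E); first exact: cvg_cst.
  rewrite /measure_seminorm (_ : [set _ | _ in _] = [set 0%E]) ?ereal_sup1//.
  apply/seteqP; split=> [_ [x _ <-]|_ ->] /=.
    by rewrite subrr vnorm0 mul0r.
  by exists 0 => //=; rewrite subrr vnorm0 mul0r.
have fd := finite_range_density.
exists density; first by exists (fun=> density).
move=> A cA; exists (fun=> density) => //.
have EA := clopen_coset_clopen S_small p_prime p_tors cA.
rewrite (_ : simple_integral _ _ _ = translate mu a A); first exact: cvg_cst.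
rewrite /simple_integral fsbig_finite//.
rewrite mu_range//; last exact: finmap.fset_uniq.
rewrite /translate; congr mu; apply/seteqP; split=> x.
  by move=> [Ax _]; exists (x + a); rewrite ?addrK.
move=> [y Ay <-]; rewrite /= subrK; split=> //=.
rewrite in_fset_set//.
by apply/mem_set; exists y.
Qed.

End density.
End measure.

(** * Generators in a separable Banach space *)

(** In the first case the powers of [p] tend to 0 in [Qp], so by continuity some power has norm
    below 1 in [K]; in characteristic [p] its image is 0. *)
Lemma vnorm_residue_lt1 {R : realType} {p : nat} {K : valuedFieldType R} :
  prime p ->
  (exists (Qp : padicFieldType R p) (i : {rmorphism Qp -> K}), continuous i)
  \/ p \in [pchar K] -> vnorm (p%:R : K) < 1.
Proof.
move=> p_prime [[Qp [i ci]]|pK]; last by rewrite pcharf0// vnorm0.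
have /nbhs_vnormP[e e0 ie] : nbhs (0 : Qp) (i @^-1` [set y | vnorm y < 1]).
  apply: (ci 0 [set y | vnorm y < 1]); rewrite rmorph0.
  by apply/nbhs_vnormP; exists 1 => // y; rewrite sub0r vnormN.
have [N] := exists_expr_lt (vnorm_ge0 _) (vnorm_t_lt1 p_prime (Q := Qp)) e0.
rewrite -vnormX -vnormN -sub0r => /ie /=.
rewrite rmorphXn rmorph_nat vnormX => pN.
rewrite ltNge; apply/negP => p1.
by move: pN; rewrite ltNge exprn_ege1.
Qed.

Lemma locally_compact_net {R : realType} {K : valuedFieldType R} :
  locally_compact [set: K] -> exists2 r : R, 0 < r &
    exists net : R -> seq K, forall e, 0 < e ->
      forall c, vnorm c <= r -> exists2 f, f \in net e & vnorm (c - f) < e.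
Proof.
move=> /(_ 0 I)[U]; rewrite withinET => /nbhs_vnormP[d d0 dU] [cU _].
exists (d / 2); first by rewrite divr_gt0.
suff netU e : exists s : seq K, 0 < e ->
    forall c, vnorm c <= d / 2 -> exists2 f, f \in s & vnorm (c - f) < e.
  have [net netP] := choice netU.
  by exists net => e e0; exact: netP.
have [e0|e0] := ltP 0 e; last by exists [::].
move: cU; rewrite compact_cover.
case/(_ K U (fun x => [set y | vnorm (y - x) < e])) => [x Ux|x Ux|D' D'U UD'].
- rewrite openE => y /= yx; apply/nbhs_vnormP; exists e => // z yz /=.
  by rewrite -(subrK y z) -addrA; apply: vnormD_lt => //; rewrite vnormB.
- by exists x => //=; rewrite subrr vnorm0.
exists (finmap.enum_fset D') => _ c cd.
have [|f fD cf] := UD' c; last by exists f.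
apply: dU; rewrite sub0r vnormN; apply: le_lt_trans cd _.
by rewrite ltr_pdivrMr// mulr_natr mulr2n ltrDl.
Qed.

Section generators.
Context {R : realType} {K : valuedFieldType R} {X : ultraBanachType K}.
Context (p : nat) (p_prime : prime p) (p_lt1 : vnorm (p%:R : K) < 1).
Context (z : nat -> X) (z_small : forall i, vnorm (z i) <= 2^-1 ^+ i).

(** Used with two families of coefficients: small ones, generating the compact group, and
    arbitrarily large ones, generating its extensions. *)
Definition gens (F : nat -> seq K) (m : nat) : seq X :=
  [seq f *: z i | i <- iota 0 m, f <- flatten [seq F n | n <- iota 0 m]].

Lemma gensP F m y : reflect
  (exists i n f, [/\ (i < m)%N, (n < m)%N, f \in F n & y = f *: z i])
  (y \in gens F m).
Proof.
apply: (iffP allpairsP) => [[[i f]] /=|[i [n [f [im nm fF ->]]]]].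
  rewrite mem_iota /= add0n => -[im /flattenP[_ /mapP[n nm ->] fF] ->].
  by exists i, n, f; rewrite mem_iota in nm.
exists (i, f); rewrite mem_iota; split=> //=; apply/flattenP.
by exists (F n) => //; apply/mapP; exists n; rewrite ?mem_iota.
Qed.

Lemma gens_mono F m m' : (m <= m')%N -> {subset gens F m <= gens F m'}.
Proof.
move=> mm' y /gensP[i [n [f [im nm fF ->]]]]; apply/gensP.
by exists i, n, f; split=> //; exact: leq_trans mm'.
Qed.

Lemma vnorm_Mp (x : X) m : vnorm (x *+ p ^ m) = vnorm (p%:R : K) ^+ m * vnorm x.
Proof. by rewrite -scaler_nat vnormZ natrX vnormX. Qed.

Lemma p_torsion (x : X) (e : R) : 0 < e -> exists m, vnorm (x *+ p ^ m) < e.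
Proof.
move=> e0; have d0 : 0 < e / (vnorm x + 1).
  by rewrite divr_gt0// ltr_wpDl ?vnorm_ge0.
have [N] := exists_expr_lt (vnorm_ge0 _) p_lt1 d0.
rewrite ltr_pdivlMr ?ltr_wpDl ?vnorm_ge0// => Ne.
exists N; rewrite vnorm_Mp; apply: le_lt_trans Ne.
by rewrite ler_wpM2l ?exprn_ge0 ?vnorm_ge0// lerDl.
Qed.

Context (r : R) (r_gt0 : 0 < r).
Context (F : nat -> seq K).
Context (F_small : forall n, {in F n, forall f, vnorm f <= r * 2^-1 ^+ n}).
Context (F_net : forall n c, vnorm c <= r * 2^-1 ^+ n ->
  exists2 f, f \in F n & vnorm (c - f) <= r * 2^-1 ^+ n.+1).
Context (F' : nat -> seq K).
Context (F'_net : forall c : K,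
  exists n, exists2 f, f \in F' n & vnorm (c - f) <= r).

Let half_le1 n : 2^-1 ^+ n <= 1 :> R.
Proof. by rewrite exprn_ile1 ?invr_ge0// invf_le1// ler1n. Qed.

Let exists_half (e : R) : 0 < e -> exists N, r * 2^-1 ^+ N < e.
Proof.
move=> e0; have [|||N Ne] := @exists_expr_lt R 2^-1 (e / r).
- by rewrite invr_ge0.
- by rewrite invf_lt1// ltr1n.
- by rewrite divr_gt0.
- by exists N; rewrite mulrC -ltr_pdivlMr.
Qed.

Local Notation G := (closed_span (gens F)).

(** The product [f *: z i] is small as soon as one of the two indices is at least [N]: either [z i]
    or the coefficient is then small, and the other stays bounded. *)
Lemma gens_small (e : R) : 0 < e ->
  exists N, forall m, {in gens F m, forall y, y \in gens F N \/ vnorm y < e}.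
Proof.
move=> /exists_half[N Ne]; exists N => m _ /gensP[i [n [f [_ _ fF ->]]]].
have [iN|Ni] := ltnP i N; last first.
  right; apply: le_lt_trans Ne; rewrite vnormZ.
  apply: ler_pM; rewrite ?vnorm_ge0//.
    by apply: le_trans (F_small fF) _; rewrite ler_piMr// ltW.
  apply: le_trans (z_small i) _.
  by apply: ler_wiXn2l; rewrite ?invr_ge0// invf_le1// ler1n.
have [nN|Nn] := ltnP n N.
  by left; apply/gensP; exists i, n, f.
right; apply: le_lt_trans Ne; rewrite vnormZ -[leRHS]mulr1.
apply: ler_pM; rewrite ?vnorm_ge0//; last exact: le_trans (z_small i) _.
apply: le_trans (F_small fF) _; rewrite ler_pM2l//.
by apply: ler_wiXn2l; rewrite ?invr_ge0// invf_le1// ler1n.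
Qed.

(** A digit expansion of [c]: its digits come from [F 0], [F 1], and so on, and modulo a ball
    finitely many of them suffice. *)
Lemma mem_span_small c i : vnorm c <= r -> G (c *: z i).
Proof.
move=> cr e e0.
pose T : set X := [set x | exists m, ext (gens F m) (vball e) x].
have sB := subgroup_vball (V := X) e0.
have sT : subgroup T.
  split=> [|x y [m xm] [m' ym']].
    by exists 0%N; exact: (subgroup_ext _ sB).1.
  exists (maxn m m'); apply: (subgroup_ext _ sB).2.
    by apply: extS xm => //; apply: gens_mono; rewrite leq_maxl.
  by apply: extS ym' => //; apply: gens_mono; rewrite leq_maxr.
(* Here [d] is the error left after [N] digits; the next digit halves its bound. *)
have approx N : exists2 d, vnorm d <= r * 2^-1 ^+ N & T ((c - d) *: z i).
  elim: N => [|N [d dN Td]].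
    by exists c; rewrite ?expr0 ?mulr1// subrr scale0r; exact: sT.1.
  have [f fN df] := F_net dN; exists (d - f) => //.
  rewrite opprB addrCA addrC scalerDl; apply: (subgroupD sT) => //.
  exists (maxn i N).+1; apply: mem_ext => //; apply/gensP.
  by exists i, N, f; rewrite !ltnS leq_maxl leq_maxr.
have [N Ne] := exists_half e0; have [d dN Td] := approx N.
rewrite -(subrK d c) scalerDl; apply: (subgroupD sT Td).
exists 0%N; rewrite /vball /= vnormZ; apply: le_lt_trans Ne.
rewrite -[leRHS]mulr1; apply: ler_pM; rewrite ?vnorm_ge0//.
exact: le_trans (z_small i) _.
Qed.

(** Multiplication by a high power of [p] brings any coefficient into the ball of radius [r], where
    [mem_span_small] applies. *)
Lemma gens_torsion n : torsion_mod p (gens F) (gens F' n).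
Proof.
move=> _ /gensP[i [_ [f [_ _ _ ->]]]].
have d0 : 0 < r / (vnorm f + 1) by rewrite divr_gt0// ltr_wpDl ?vnorm_ge0.
have [N] := exists_expr_lt (vnorm_ge0 _) p_lt1 d0.
rewrite ltr_pdivlMr ?ltr_wpDl ?vnorm_ge0// => Nr.
exists N; rewrite -scaler_nat scalerA; apply: mem_span_small.
rewrite vnormM natrX vnormX; apply: le_trans (ltW Nr).
by rewrite ler_wpM2l ?exprn_ge0 ?vnorm_ge0// lerDl.
Qed.

(** A coefficient from [F'] approximates [c] up to [r], and the error contributes an element of
    [G]. *)
Lemma mem_ext_scale c i : exists M, ext (gens F' M) G (c *: z i).
Proof.
have [n [f fF cf]] := F'_net c.
have sG : subgroup G by exact: subgroup_closed_span gens_small.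
exists (maxn i n).+1; rewrite -(subrK f c) scalerDl.
apply: subgroupD; first exact: subgroup_ext.
  by apply: sub_ext; exact: mem_span_small.
apply: mem_ext => //; apply/gensP.
by exists i, n, f; rewrite !ltnS leq_maxl leq_maxr.
Qed.

End generators.

(** The largest [K]-subspace contained in the union of the subgroups
[ext (W n) G]. *)
Definition shift_space {R : realType} {K : valuedFieldType R}
    {X : ultraBanachType K} (S W : nat -> seq X) : {pred X} :=
  [pred x | `[< forall c : K, exists n, ext (W n) (closed_span S) (c *: x) >]].

Lemma submod_closed_shift_space {R : realType} {K : valuedFieldType R}
    {X : ultraBanachType K} (S W : nat -> seq X) :
  subgroup (closed_span S) ->
  (forall m m', (m <= m')%N -> {subset W m <= W m'}) ->
  submod_closed (shift_space S W).
Proof.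
move=> sG W_mono; have sH n := subgroup_ext (W n) sG; split.
  by apply/asboolP => c; exists 0%N; rewrite scaler0; exact: (sH _).1.
move=> a u v /asboolP Ju /asboolP Jv; apply/asboolP => c.
have [n un] := Ju (c * a); have [m vm] := Jv c.
exists (maxn n m); rewrite scalerDr scalerA; apply: (subgroupD (sH _)).
  by apply: extS un => //; apply: W_mono; rewrite leq_maxl.
by apply: extS vm => //; apply: W_mono; rewrite leq_maxr.
Qed.

Theorem theorem3p15 (R : realType) (p s : nat) (p_prime : prime p)
    (s_prime : prime s) (neq_sp : s != p)
    (K : valuedFieldType R)
    (K_infinite : infinite_set [set: K])
    (K_locally_compact : locally_compact [set: K])
    (K_nontrivial : exists2 x : K, x != 0 & vnorm x != 1)
    (K_residue :
      (exists (Qp : padicFieldType R p) (i : {rmorphism Qp -> K}),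
         continuous i)
      \/ p \in [pchar K])
    (X : ultraBanachType K)
    (X_separable : exists2 D : set X, countable D & dense D)
    (Qs : padicFieldType R s) (Ks : valuedFieldExtType Qs) :
  exists (E : set (set X)) (mu : set X -> Ks),
    [/\ is_measure E mu, is_probability E mu
      & exists J : {pred X}, quasi_invariant E mu J].
Proof.
have p_lt1 := vnorm_residue_lt1 p_prime K_residue.
have [r r0 [net netP]] := locally_compact_net K_locally_compact.
have [b b0 b1] : exists2 b : K, b != 0 & vnorm b < 1.
  have [x x0] := K_nontrivial; rewrite neq_lt => /orP[x1|x1]; first by exists x.
  by exists x^-1; rewrite ?invr_eq0// vnormV invf_lt1// (lt_trans _ x1).
have bn0 n : b ^+ n != 0 by rewrite expf_neq0.
have vb0 n : 0 < vnorm b ^+ n.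
  by rewrite -vnormX lt_neqAle vnorm_ge0 andbT eq_sym vnorm_eq0.
have half0 n : 0 < 2^-1 ^+ n :> R by rewrite exprn_gt0// invr_gt0.
have [D /countable_injP[g g_inj] D_dense] := X_separable.
(* An enumeration of [D] by inverting the injection [g]; indices outside its image receive 0. *)
pose x i := xget 0 [set y | D y /\ g y = i].
have xg d : D d -> x (g d) = d.
  move=> Dd; apply: xget_unique => // y [Dy gy].
  by apply: g_inj => //; exact/mem_set.
have /choice[k kP] i : exists k, vnorm (b ^+ k *: x i) <= 2^-1 ^+ i.
  have d0 : 0 < 2^-1 ^+ i / (vnorm (x i) + 1).
    by rewrite divr_gt0// ltr_wpDl ?vnorm_ge0.
  have [N] := exists_expr_lt (vnorm_ge0 _) b1 d0.
  rewrite ltr_pdivlMr ?ltr_wpDl ?vnorm_ge0// => Ni.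
  exists N; rewrite vnormZ vnormX; apply: le_trans (ltW Ni).
  by rewrite ler_wpM2l ?(ltW (vb0 _))// lerDl.
pose z i := b ^+ k i *: x i.
have z_small i : vnorm (z i) <= 2^-1 ^+ i by exact: kP.
(* The digits at stage [n]: a net of the ball of radius [r / 2^n] with mesh [r / 2^(n+1)]. *)
pose F n := [seq f <- net (r * 2^-1 ^+ n.+1) | vnorm f <= r * 2^-1 ^+ n].
(* Dividing by [b ^+ n] spreads a fine net of the ball of radius [r] into a net of mesh [r] on a
   ball of radius [r / |b|^n]; these balls exhaust [K]. *)
pose F' n := [seq f / b ^+ n | f <- net (r * vnorm b ^+ n)].
have F_small n : {in F n, forall f, vnorm f <= r * 2^-1 ^+ n}.
  by move=> f; rewrite mem_filter => /andP[].
have F_net n c : vnorm c <= r * 2^-1 ^+ n ->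
    exists2 f, f \in F n & vnorm (c - f) <= r * 2^-1 ^+ n.+1.
  move=> cn; have e0 : 0 < r * 2^-1 ^+ n.+1 by rewrite mulr_gt0.
  have half1 m : 2^-1 ^+ m <= 1 :> R.
    by rewrite exprn_ile1 ?invr_ge0// invf_le1// ler1n.
  have [|f fnet cf] := netP _ e0 c.
    by apply: le_trans cn _; rewrite ler_piMr// ltW.
  exists f; last exact: ltW.
  rewrite mem_filter fnet andbT -[f](subKr c); apply: vnormB_le => //.
  apply: le_trans (ltW cf) _.
  rewrite ler_pM2l// exprS ler_piMl ?(ltW (half0 _))//.
  by rewrite invf_le1// ler1n.
have F'_net (c : K) : exists n, exists2 f, f \in F' n & vnorm (c - f) <= r.
  have d0 : 0 < r / (vnorm c + 1) by rewrite divr_gt0// ltr_wpDl ?vnorm_ge0.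
  have [n] := exists_expr_lt (vnorm_ge0 _) b1 d0.
  rewrite ltr_pdivlMr ?ltr_wpDl ?vnorm_ge0// => nr.
  have [||f fnet cf] := netP (r * vnorm b ^+ n) _ (b ^+ n * c).
  - by rewrite mulr_gt0.
  - rewrite vnormM vnormX; apply: le_trans (ltW nr).
    by rewrite ler_wpM2l ?(ltW (vb0 _))// lerDl.
  exists n, (f / b ^+ n); first exact: map_f.
  rewrite -(ler_pM2r (vb0 n)) -vnormX -vnormM mulrBl divfK// mulrC vnormX.
  exact: ltW.
have S_mono := @gens_mono _ _ _ z F; have W_mono := @gens_mono _ _ _ z F'.
have S_small := gens_small z_small r0 F_small.
have p_tors := @p_torsion R K X p p_lt1.
have W_tors := gens_torsion p_lt1 z_small r0 F_net (F' := F').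
have sG := subgroup_closed_span S_small.
exists (coset_clopen (gens z F)), (mu (p := p) (gens z F) (gens z F')); split.
- exact: (is_measure_mu p_prime s_prime neq_sp S_mono S_small).
- exact: (is_probability_mu p_prime s_prime neq_sp S_mono S_small).
exists (shift_space (gens z F) (gens z F')); split.
- exact: submod_closed_shift_space.
- move=> O O0 oO; have [y [Oy Dy]] := D_dense _ O0 oO.
  exists y; split=> //; apply/asboolP => c.
  (* The quotient by [b ^+ k (g y)] undoes the scaling that made [z] a null sequence, so every
     multiple of a point of [D] is reached. *)
  have [M cM] := mem_ext_scale z_small r0 F_small F_net F'_net
    (c / b ^+ k (g y)) (g y).
  by exists M; move: cM; rewrite /z scalerA divfK// xg.
(* The scalar 1 places the shift itself in one of the groups, where a density exists. *)
- move=> y /asboolP/(_ 1)[M]; rewrite scale1r => yM.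
  exact: (admissible_shift p_prime s_prime neq_sp S_mono S_small _ _ _ yM).
Qed.
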